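(* Let $PV_3$ be the group with generators $\lambda_{12},\lambda_{21},\lambda_{13},\lambda_{31},\lambda_{23},\lambda_{32}$ and the six defining relations $\lambda_{ki}\lambda_{kj}\lambda_{ij}=\lambda_{ij}\lambda_{kj}\lambda_{ki}$ for every ordering $(k,i,j)$ of the three distinct indices $1,2,3$. Put $a_1=\lambda_{13}\lambda_{23}$, $b_1=\lambda_{13}\lambda_{12}$, $a_2=\lambda_{32}\lambda_{31}$, $b_2=\lambda_{21}\lambda_{31}$, $c_1=\lambda_{13}\lambda_{31}$, $c_2=\lambda_{13}$, and let $A_1,B_1,A_2,B_2,C_1,C_2$ be their classes in $\gamma_1(PV_3)/\gamma_2(PV_3)$. Then the associated graded Lie ring $L(PV_3)=\bigoplus_{i\ge1}\gamma_i(PV_3)/\gamma_{i+1}(PV_3)$ is the quotient of the free Lie ring $L(A_1,B_1,A_2,B_2,C_1,C_2)$ on these six generators by the relations $$[A_1,B_1]=0,\quad [A_2,B_2]=0,$$ $$[C_1,B_1]=[A_2,B_1],\quad [C_1,A_1]=[B_2,A_1],\quad [C_1,B_2]=[A_1,B_2],\quad [C_1,A_2]=[B_1,A_2].$$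
   Context: $\gamma_i(G)$ is the lower central series ($\gamma_1(G)=G$, $\gamma_{i+1}(G)=[\gamma_i(G),G]$), and $L(G)$ carries the Lie bracket induced by group commutators; Lie rings are over $\mathbb{Z}$. *)

(* Defs.v *)
From HB Require Import structures.
From mathcomp Require Import all_boot all_order all_algebra.

Set Implicit Arguments.
Unset Strict Implicit.
Unset Printing Implicit Defensive.

Import GRing.Theory.

Section GroupDefs.
Variable G : groupType.
Local Open Scope group_scope.

Definition is_subgroup (H : G -> Prop) : Prop :=
  H 1 /\ (forall x y, H x -> H y -> H (x * y^-1)).

Definition gen_subgroup (S : G -> Prop) : G -> Prop :=
  fun x => forall H, is_subgroup H -> (forall y, S y -> H y) -> H x.

(* Lower central series, shifted by one:  lcs d = gamma_{d+1}(G),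
   so lcs 0 = G and lcs d.+1 = [lcs d, G]. *)
Fixpoint lcs (d : nat) : G -> Prop :=
  match d with
  | 0 => fun _ => True
  | d'.+1 => gen_subgroup (fun z => exists x y, lcs d' x /\ z = [~ x, y])
  end.

(* x and y have the same class in gamma_{d+1}/gamma_{d+2}  (both assumed
   in gamma_{d+1}):  x y^-1 in gamma_{d+2}. *)
Definition same_class (d : nat) (x y : G) : Prop := lcs d.+1 (x * y^-1).

(* The Lie subring of L(G) generated by the classes (in degree 0, i.e.
   gamma_1/gamma_2) of the elements of [gens]:  [lie_span gens d x] means
   that x (in gamma_{d+1}) represents an element of the degree-(d+1)
   component of that Lie subring. *)
Inductive lie_span (gens : seq G) : nat -> G -> Prop :=
| ls_gen x : x \in gens -> lie_span gens 0 x
| ls_sub d x y : lie_span gens d x -> lie_span gens d y ->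
                 lie_span gens d (x * y^-1)
| ls_br d e x y : lie_span gens d x -> lie_span gens e y ->
                  lie_span gens (d + e).+1 [~ x, y]
| ls_mod d x y : lie_span gens d x -> lcs d.+1 y -> lie_span gens d (x * y).

End GroupDefs.

Definition group_hom (G H : groupType) (f : G -> H) : Prop :=
  forall x y, f (x * y)%g = (f x * f y)%g.

Definition idx3 (i : nat) : bool := i \in [:: 1; 2; 3].

Definition PV3_rel (H : groupType) (mu : nat -> nat -> H) : Prop :=
  forall k i j, idx3 k -> idx3 i -> idx3 j -> k != i -> k != j -> i != j ->
    (mu k i * mu k j * mu i j = mu i j * mu k j * mu k i)%g.

Definition presents_PV3 (G : groupType) (lam : nat -> nat -> G) : Prop :=
  PV3_rel lam /\
  forall (H : groupType) (mu : nat -> nat -> H), PV3_rel mu ->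
    exists f : G -> H,
      [/\ group_hom f,
          (forall i j, idx3 i -> idx3 j -> i != j -> f (lam i j) = mu i j) &
          (forall g : G -> H, group_hom g ->
             (forall i j, idx3 i -> idx3 j -> i != j -> g (lam i j) = mu i j) ->
             forall x, g x = f x)].

Definition lie_ring (M : zmodType) (br : M -> M -> M) : Prop :=
  [/\ (forall x y z, br (x + y) z = br x z + br y z)%R,
      (forall x y z, br x (y + z) = br x y + br x z)%R,
      (forall x, br x x = 0)%R &
      (forall x y z, br x (br y z) + br y (br z x) + br z (br x y) = 0)%R].

(* A Lie ring homomorphism L(G) = (+)_{d} gamma_{d+1}/gamma_{d+2} -> M,
   given by its homogeneous components f d : gamma_{d+1} -> M, which are
   additive, vanish on gamma_{d+2}, and carry group commutators of
   homogeneous elements to brackets. *)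
Definition graded_lie_hom (G : groupType) (M : zmodType) (br : M -> M -> M)
    (f : nat -> G -> M) : Prop :=
  [/\ (forall d x y, lcs d x -> lcs d y -> f d (x * y)%g = (f d x + f d y)%R),
      (forall d x, lcs d.+1 x -> f d x = 0%R) &
      (forall d e x y, lcs d x -> lcs e y ->
         f (d + e).+1 [~ x, y]%g = br (f d x) (f e y))].

Definition PV3_lie_rel (M : zmodType) (br : M -> M -> M)
    (A1 B1 A2 B2 C1 C2 : M) : Prop :=
  [/\ br A1 B1 = 0%R, br A2 B2 = 0%R,
      br C1 B1 = br A2 B1, br C1 A1 = br B2 A1 &
      [/\ br C1 B2 = br A1 B2 & br C1 A2 = br B1 A2]].

Section PV3Elements.
Variables (G : groupType) (lam : nat -> nat -> G).
Definition PV3_a1 : G := (lam 1%N 3%N * lam 2%N 3%N)%g.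
Definition PV3_b1 : G := (lam 1%N 3%N * lam 1%N 2%N)%g.
Definition PV3_a2 : G := (lam 3%N 2%N * lam 3%N 1%N)%g.
Definition PV3_b2 : G := (lam 2%N 1%N * lam 3%N 1%N)%g.
Definition PV3_c1 : G := (lam 1%N 3%N * lam 3%N 1%N)%g.
Definition PV3_c2 : G := lam 1%N 3%N.
End PV3Elements.

(* Main.v *)
Require Import Defs.
From HB Require Import structures.
From mathcomp Require Import all_boot all_order all_algebra.
From mathcomp Require Import boolp functions.

(* The relations of PV_3 say exactly that, in the generators a1, ..., c2, the
   pairs (a1, b1), (a2, b2), (a2 c1^-1, b1), (b2 c1^-1, a1), (c1^-1 a1, b2) and
   (c1^-1 b1, a2) commute.  So a1 and a2 generate a free group acting on the free
   group on b1, b2, c1, trivially on its abelianization, while c2 is free.  On the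
   Lie side the elements A1, A2 act by derivations on the Lie subring generated by
   B1, B2, C1 and Z_w := [.. [C2, A_i] .., A_j], w running over the words in two
   letters, and what has to be shown is that both parts are free.

   This is certified by letting PV_3 act on formal power series with coefficients
   operators on functions of words in the letters B1, B2, C, Z_w: the elements b1,
   b2, c1, c2 act as 1 + t d_e, with d_e the operator stripping the letter e, and
   a1, a2 as automorphisms.  An element of gamma_(d+1) acts as 1 + t^(d+1) D + ..,
   and D lies in the Lie ring of operators generated by the degree one symbols.
   Given M, the map sought sends the class of g to the element of M paired with D
   in the Lie ring generated by the six pairs (symbol, element of M).  It is well
   defined because a pair (0, m) in that Lie ring has m = 0: the pairs are integral
   combinations of Lyndon brackets, and the operators attached to distinct Lyndon
   brackets are linearly independent by triangularity. *)

Set Implicit Arguments.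
Unset Strict Implicit.
Unset Printing Implicit Defensive.
Import GRing.Theory.

(** * Lyndon words *)

Section Words.
Variable T : countType.
Implicit Types (s t u v w : seq T).

(** [pickle] supplies a total order on the letters of an arbitrary countable type. *)
Fixpoint ltw s t :=
  match s, t with
  | _, [::] => false
  | [::], _ => true
  | x :: s', y :: t' => (pickle x < pickle y) || (x == y) && ltw s' t'
  end.

Lemma ltww s : ltw s s = false.
Proof. by elim: s => //= x s ->; rewrite ltnn eqxx. Qed.

Lemma ltw_trans : transitive ltw.
Proof.
move=> t s u; elim: s t u => [|x s IH] [|y t] [|z u] //=.
case/orP=> [xy|/andP[/eqP-> st]]; case/orP=> [yz|/andP[/eqP<- tu]].
- by rewrite (ltn_trans xy yz).
- by rewrite xy.
- by rewrite yz.
- by rewrite eqxx (IH _ _ st tu) orbT.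
Qed.

Lemma ltw_total s t : [|| ltw s t, s == t | ltw t s].
Proof.
elim: s t => [|x s IH] [|y t] //=; rewrite eqseq_cons.
case: (ltngtP (pickle x) (pickle y)) => //= [_|/(pcan_inj pickleK) ->].
  by rewrite !orbT.
by rewrite eqxx /=.
Qed.

Lemma ltw_catl s t u : ltw (s ++ t) (s ++ u) = ltw t u.
Proof. by elim: s => //= x s ->; rewrite ltnn eqxx. Qed.

Lemma ltw_prefix s t : t != [::] -> ltw s (s ++ t).
Proof. by move=> t0; rewrite -[X in ltw X](cats0 s) ltw_catl; case: t t0. Qed.

Lemma ltw_nprefix s t u v : ltw s t -> ~~ prefix s t -> ltw (s ++ u) (t ++ v).
Proof.
elim: s t => [|x s IH] [|y t] //=.
case/orP=> [->//|/andP[/eqP-> st]]; rewrite eqxx /= => np.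
by rewrite (IH _ st np) orbT.
Qed.

Lemma ltw_cat s t u v : ltw s t -> size t <= size s -> ltw (s ++ u) (t ++ v).
Proof.
elim: s t => [|x s IH] [|y t] //=.
case/orP=> [->//|/andP[/eqP-> st]] sz.
by rewrite eqxx (IH _ st) ?orbT.
Qed.

Lemma ltw_asym s t : ltw s t -> ltw t s = false.
Proof. by move=> st; apply/negP=> ts; move: (ltw_trans st ts); rewrite ltww. Qed.

Definition lew s t := (s == t) || ltw s t.

Lemma leww s : lew s s. Proof. by rewrite /lew eqxx. Qed.

Lemma ltwW s t : ltw s t -> lew s t.
Proof. by rewrite /lew orbC => ->. Qed.

Lemma ltw_lew_trans s t u : ltw s t -> lew t u -> ltw s u.
Proof. by move=> st /orP[/eqP<-|] //; apply: ltw_trans st. Qed.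

Lemma lew_trans : transitive lew.
Proof.
by move=> t s u /orP[/eqP->|st] // tu; apply/ltwW/(ltw_lew_trans st tu).
Qed.

Lemma ltwNge s t : ltw s t = ~~ lew t s.
Proof.
rewrite /lew; case/or3P: (ltw_total s t) => [st|/eqP->|ts].
- by rewrite st (ltw_asym st) orbF; apply/esym/eqP=> e; rewrite e ltww in st.
- by rewrite ltww eqxx.
- by rewrite ts orbT (ltw_asym ts).
Qed.

Definition lyndon w := (w != [::]) &&
  [forall i : 'I_(size w), (0 < i) ==> ltw w (drop i w)].

Lemma lyndonP w :
  reflect (w <> [::] /\ forall s t, w = s ++ t -> s <> [::] -> t <> [::] -> ltw w t)
          (lyndon w).
Proof.
apply: (iffP andP) => [[/eqP w0 /forallP wP]|[w0 wP]]; split=> //.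
- move=> s t e s0 t0.
  have szw : size s < size w.
    by rewrite e size_cat -[X in X < _]addn0 ltn_add2l lt0n size_eq0; apply/eqP.
  have /implyP := wP (Ordinal szw); rewrite /= [X in drop _ X]e drop_size_cat //; apply.
  by case: (s) s0.
- exact/eqP.
- apply/forallP=> i; apply/implyP=> i0.
  apply: (wP (take i w)); first by rewrite cat_take_drop.
    by move=> /(congr1 size); rewrite size_take ltn_ord /=; case: (val i) i0.
  by move=> /(congr1 size); rewrite size_drop /= => /eqP; rewrite subn_eq0 leqNgt ltn_ord.
Qed.

Lemma lyndon_neq0 w : lyndon w -> w <> [::].
Proof. by case/lyndonP. Qed.

Lemma lyndon1 x : lyndon [:: x].
Proof. by apply/lyndonP; split=> // -[|a [|b s]] [|c t]. Qed.

(** A Lyndon word and its proper suffix already differ inside the suffix, the shorter of the two, so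
    continuing both words does not change the comparison. *)
Lemma lyndon_suffix s t u v : lyndon (s ++ t) -> s <> [::] -> t <> [::] ->
  ltw (s ++ t ++ u) (t ++ v).
Proof.
move=> /lyndonP[_ H] s0 t0; rewrite catA; apply: ltw_cat; first exact: (H s t).
by rewrite size_cat leq_addl.
Qed.

Lemma cat_eq_split a b s t : a ++ b = s ++ t -> size a <= size s ->
  exists2 r, s = a ++ r & b = r ++ t.
Proof.
move=> e les; have es : s = a ++ drop (size a) s.
  rewrite -[LHS](cat_take_drop (size a)); congr (_ ++ _).
  by rewrite -(takel_cat t les) -e take_size_cat.
exists (drop (size a) s) => //; move: e; rewrite es -catA => /eqP.
by rewrite eqseq_cat // eqxx -es => /eqP.
Qed.

(** If b = a c, then b < c because b is Lyndon, whence a b < a c. If a is not a prefix of b, the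
    first differing letter decides. *)
Lemma lyndon_cat_lt a b : lyndon a -> lyndon b -> ltw a b -> ltw (a ++ b) b.
Proof.
move=> La Lb ab; case: (boolP (prefix a b)) => [/prefixP[c e]|np].
  rewrite e in Lb *; rewrite ltw_catl -e; rewrite {}e in Lb ab *.
  have c0 : c <> [::] by move=> c0; rewrite c0 cats0 ltww in ab.
  have /lyndonP[_] := Lb; apply=> //; exact: lyndon_neq0.
by rewrite -[X in ltw _ X]cats0; apply: ltw_nprefix.
Qed.

(** A proper suffix of a b either lies in b, hence is at least b, or is r b with r a proper suffix
    of a, where [lyndon_suffix] applies. *)
Lemma lyndon_cat a b : lyndon a -> lyndon b -> ltw a b -> lyndon (a ++ b).
Proof.
move=> La Lb ab; have a0 := lyndon_neq0 La; have b0 := lyndon_neq0 Lb.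
have abb := lyndon_cat_lt La Lb ab.
apply/lyndonP; split; first by case: (a) a0.
move=> s t e s0 t0.
have [les|/ltnW lts] := leqP (size a) (size s).
- have [[|x r] e1 e2] := cat_eq_split e les; first by rewrite {2}e2 in abb.
  apply: ltw_trans abb _; have /lyndonP[_ H] := Lb.
  by apply: (H (x :: r)).
- have [r e1 e2] := cat_eq_split (esym e) lts.
  case: r e1 e2 => [_ /= ->//|x r] e1 ->.
  by rewrite e1 -catA; apply: lyndon_suffix => //; rewrite -e1.
Qed.

(** * Standard factorization of Lyndon words *)

Fixpoint minsuf w :=
  if w is x :: s then
    if s is [::] then w else if ltw w (minsuf s) then w else minsuf s
  else [::].

Lemma minsuf_cons2 x y s : let t := y :: s in
  minsuf (x :: t) = if ltw (x :: t) (minsuf t) then x :: t else minsuf t.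
Proof. by []. Qed.

Lemma minsuf_suffix w : exists p, w = p ++ minsuf w.
Proof.
elim: w => [|x [|y s] [p e]]; [by exists [::] | by exists [::] |].
rewrite minsuf_cons2; case: ifP => _; first by exists [::].
by exists (x :: p); rewrite cat_cons -e.
Qed.

Lemma minsuf_neq0 w : w <> [::] -> minsuf w <> [::].
Proof.
elim: w => // x [|y s] IH _ //; rewrite minsuf_cons2.
by case: ifP => // _; apply: IH.
Qed.

Lemma minsuf_min w p t : w = p ++ t -> t <> [::] -> lew (minsuf w) t.
Proof.
elim: w p => [|x [|y s] IH] p.
- by case: p => //= <-.
- by case: p => [/= <- _|a [|b p]] //=; [rewrite leww|case=> _ <-].
move=> e t0; rewrite minsuf_cons2.
case: p e => [e|a p [_ e]].
  by rewrite -[t]e; case: ifPn => [_|]; [apply: leww | rewrite ltwNge negbK].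
have := IH p e t0 => H.
by case: ifPn => [lt|//]; apply/ltwW/(ltw_lew_trans lt).
Qed.

(** The right standard factor: the smallest proper suffix of a Lyndon word is also its longest
    proper Lyndon suffix. *)
Definition rfac w := minsuf (behead w).
Definition lfac w := take (size w - size (rfac w)) w.

Lemma fac_cat w : w = lfac w ++ rfac w.
Proof.
rewrite /lfac /rfac; case: w => [|x s] //=.
have [p e] := minsuf_suffix s; set n := minsuf s in e *.
have -> : (size s).+1 - size n = (size p).+1 by rewrite e size_cat -addSn addnK.
by rewrite e /= take_size_cat.
Qed.

Lemma rfac_min w s t : w = s ++ t -> s <> [::] -> t <> [::] -> lew (rfac w) t.
Proof. by case: s => // x s -> _ t0; apply: (@minsuf_min _ s). Qed.

Lemma rfac_neq0 w : 1 < size w -> rfac w <> [::].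
Proof. by case: w => [|x [|y s]] // _; apply: minsuf_neq0. Qed.

Lemma lfac_neq0 w : 1 < size w -> lfac w <> [::].
Proof.
case: w => [|x s] // sz e; have /(congr1 size) := fac_cat (x :: s).
rewrite e /rfac /=; have [p /(congr1 size)] := minsuf_suffix s.
by rewrite size_cat => -> /eqP; rewrite gtn_eqF // ltnS leq_addl.
Qed.

Lemma cat_neq0r s t : t <> [::] -> s ++ t <> [::].
Proof. by case: s. Qed.

Lemma rfac_lyndon w : 1 < size w -> lyndon (rfac w).
Proof.
move=> sz; apply/lyndonP; split; first exact: rfac_neq0.
move=> s t e s0 t0.
have /orP[/eqP e2|//] : lew (rfac w) t.
  apply: (@rfac_min _ (lfac w ++ s)) => //; last exact: cat_neq0r.
  by rewrite -catA -e -fac_cat.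
by move: e; rewrite e2 => /(congr1 size); rewrite size_cat; case: s s0 => //= a s _ /eqP;
   rewrite ltn_eqF // ltnS leq_addl.
Qed.

Lemma fac_lt w : lyndon w -> 1 < size w -> ltw w (rfac w).
Proof.
move=> /lyndonP[_ H] sz; apply: (H (lfac w)); first exact: fac_cat.
  exact: lfac_neq0.
exact: rfac_neq0.
Qed.

Lemma lfac_ltw w : 1 < size w -> ltw (lfac w) w.
Proof. by move=> sz; rewrite {2}(fac_cat w); apply/ltw_prefix/eqP/rfac_neq0. Qed.

(** Suppose w = m n and some proper suffix s of m has s <= m; w being Lyndon, m n < s n. If m = s r,
    cancelling s gives r n < n against the minimality of n; otherwise s < m is decided at a letter
    and s n < m n. *)
Lemma lfac_lyndon w : lyndon w -> 1 < size w -> lyndon (lfac w).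
Proof.
move=> Lw sz; apply/lyndonP; split; first exact: lfac_neq0.
set m := lfac w; set n := rfac w; have n0 : n <> [::] by apply: rfac_neq0.
have ew : w = m ++ n := fac_cat w.
move=> t s e t0 s0; rewrite ltwNge; apply/negP => sm.
have lt1 : ltw (m ++ n) (s ++ n).
  rewrite -ew; have /lyndonP[_ H] := Lw.
  by apply: (H t) => //; [rewrite catA -e | apply: cat_neq0r].
case: (boolP (prefix s m)) => [/prefixP[r er]|np].
- have r0 : r <> [::].
    move=> r0; have /(congr1 size) := e; rewrite er r0 cats0 size_cat => /eqP.
    by case: (t) t0 => //= a t' _; rewrite ltn_eqF // ltnS leq_addl.
  have : ltw (r ++ n) n by rewrite er -catA ltw_catl in lt1.
  rewrite ltwNge => /negP; apply.
  by apply: (@rfac_min _ s) => //; [rewrite catA -er | apply: cat_neq0r].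
- case/orP: sm => [/eqP es|sm]; first by rewrite es prefix_refl in np.
  by have := ltw_asym lt1; rewrite ltw_nprefix.
Qed.

Lemma lfac_lt_rfac w : lyndon w -> 1 < size w -> ltw (lfac w) (rfac w).
Proof. by move=> Lw sz; apply: ltw_trans (lfac_ltw sz) (fac_lt Lw sz). Qed.

(** A suffix of a b competing with b is either inside b, hence not smaller, or of the form r b with
    b <= [rfac a] <= r < r b. *)
Lemma rfac_cat a b : lyndon a -> lyndon b -> ltw a b ->
  (1 < size a -> lew b (rfac a)) -> rfac (a ++ b) = b.
Proof.
move=> La Lb ab H; have a0 := lyndon_neq0 La; have b0 := lyndon_neq0 Lb.
have sz : 1 < size (a ++ b).
  by rewrite size_cat; case: (a) a0 => // x a' _; case: (b) b0 => // y b' _;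
     rewrite addSn addnS.
have le1 : lew (rfac (a ++ b)) b by apply: (@rfac_min _ a).
set n := rfac _ in le1 *; set p := lfac (a ++ b).
have e : a ++ b = p ++ n by apply: fac_cat.
have p0 : p <> [::] by apply: lfac_neq0.
have n0 : n <> [::] by apply: rfac_neq0.
case/orP: le1 => [/eqP//|lt1]; exfalso; move: lt1; rewrite ltwNge => /negP; apply.
have [les|lts] := leqP (size a) (size p).
- have [[|x r] e1 e2] := cat_eq_split e les; first by rewrite e2; apply: leww.
  have /lyndonP[_ Hb] := Lb; apply/ltwW; exact: (Hb (x :: r)).
- have [r e1 e2] := cat_eq_split (esym e) (ltnW lts).
  have r0 : r <> [::] by move=> r0; rewrite e1 r0 cats0 ltnn in lts.
  have sza : 1 < size a.
    rewrite e1 size_cat; case: (p) p0 => // x p' _; case: (r) r0 => // y r' _.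
    by rewrite addSn addnS.
  rewrite e2; apply: lew_trans (H sza) _.
  apply: lew_trans (rfac_min e1 p0 r0) _; exact/ltwW/ltw_prefix/eqP.
Qed.

Lemma lfac_eq w n p : w = p ++ n -> rfac w = n -> lfac w = p.
Proof.
move=> e r; have := fac_cat w; rewrite r {1}e => /eqP.
have sz : size p = size (lfac w).
  have := congr1 size (fac_cat w); rewrite r {1}e !size_cat => /eqP.
  by rewrite eqn_add2r => /eqP.
by rewrite eqseq_cat // => /andP[/eqP].
Qed.

End Words.

(** * Lyndon brackets span the Lie subring generated by the letters *)

Local Open Scope ring_scope.

Section IntegralSpan.
Variable L : zmodType.
Implicit Types (S : L -> Prop) (x y z : L).

Inductive zspan S : L -> Prop :=
| zspan0 : zspan S 0
| zspan_gen x : S x -> zspan S x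
| zspanB x y : zspan S x -> zspan S y -> zspan S (x - y).

Lemma zspanN S x : zspan S x -> zspan S (- x).
Proof. by move=> Sx; rewrite -sub0r; apply: zspanB => //; apply: zspan0. Qed.

Lemma zspan_bind S S' x :
  (forall y, S y -> zspan S' y) -> zspan S x -> zspan S' x.
Proof. by move=> SS'; elim=> [|y /SS'|y z _ ? _ ?] //; [apply: zspan0|apply: zspanB]. Qed.

End IntegralSpan.

Section LieRing.
Variables (L : zmodType) (br : L -> L -> L).
Hypothesis brP : lie_ring br.
Implicit Types (S : L -> Prop) (x y z : L).

Lemma brDl x y z : br (x + y) z = br x z + br y z. Proof. by case: brP. Qed.
Lemma brDr x y z : br x (y + z) = br x y + br x z. Proof. by case: brP. Qed.
Lemma brxx x : br x x = 0. Proof. by case: brP. Qed.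

Lemma br0l x : br 0 x = 0.
Proof. by apply: (@addrI _ (br 0 x)); rewrite -brDl !addr0. Qed.
Lemma br0r x : br x 0 = 0.
Proof. by apply: (@addrI _ (br x 0)); rewrite -brDr !addr0. Qed.
Lemma brNl x y : br (- x) y = - br x y.
Proof. by apply/eqP; rewrite -addr_eq0 -brDl addNr br0l. Qed.
Lemma brNr x y : br x (- y) = - br x y.
Proof. by apply/eqP; rewrite -addr_eq0 -brDr addNr br0r. Qed.
Lemma brBl x y z : br (x - y) z = br x z - br y z. Proof. by rewrite brDl brNl. Qed.
Lemma brBr x y z : br x (y - z) = br x y - br x z. Proof. by rewrite brDr brNr. Qed.

Lemma brC x y : br x y = - br y x.
Proof.
apply/eqP; rewrite -addr_eq0; have := brxx (x + y).
by rewrite brDl !brDr !brxx add0r addr0 => ->.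
Qed.

Lemma br_jacobi x y z : br (br x y) z = br x (br y z) - br y (br x z).
Proof.
have [_ _ _ J] := brP; have := J x y z; rewrite (brC z (br x y)) (brC z x) brNr.
by move/eqP; rewrite subr_eq0 => /eqP ->.
Qed.

Lemma br_leibniz x y z : br x (br y z) = br (br x y) z + br y (br x z).
Proof. by rewrite br_jacobi subrK. Qed.

Inductive lie_gen S : L -> Prop :=
| lie_gen0 : lie_gen S 0
| lie_gen_in x : S x -> lie_gen S x
| lie_genB x y : lie_gen S x -> lie_gen S y -> lie_gen S (x - y)
| lie_gen_br x y : lie_gen S x -> lie_gen S y -> lie_gen S (br x y).

Lemma lie_genN S x : lie_gen S x -> lie_gen S (- x).
Proof. by move=> Sx; rewrite -sub0r; apply: lie_genB => //; apply: lie_gen0. Qed.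

Lemma lie_genD S x y : lie_gen S x -> lie_gen S y -> lie_gen S (x + y).
Proof. by move=> Sx Sy; rewrite -[y]opprK; apply/lie_genB/lie_genN. Qed.

Lemma zspan_br S1 S2 S x y :
  (forall a b, S1 a -> S2 b -> zspan S (br a b)) ->
  zspan S1 x -> zspan S2 y -> zspan S (br x y).
Proof.
move=> H; elim=> [|a S1a|a b _ IHa _ IHb] Sy; first by rewrite br0l; apply: zspan0.
  elim: Sy => [|b /(H a b S1a)//|b c _ IHb _ IHc].
    by rewrite br0r; apply: zspan0.
  by rewrite brBr; apply: zspanB.
by rewrite brBl; apply: zspanB; [apply: IHa | apply: IHb].
Qed.

(** [br x] is a derivation, so testing it on generators is enough. *)
Lemma lie_gen_der S x y :
  (forall s, S s -> lie_gen S (br x s)) -> lie_gen S y -> lie_gen S (br x y).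
Proof.
move=> H; elim=> [|s /H//|a b _ IHa _ IHb|a b Sa IHa Sb IHb].
- by rewrite br0r; apply: lie_gen0.
- by rewrite brBr; apply: lie_genB.
- by rewrite br_leibniz; apply: lie_genD; apply: lie_gen_br.
Qed.

Section Lyndon.
Variables (T : countType) (u : T -> L).
Implicit Types (a b l w : seq T).

(** [n] is fuel: the standard factors are shorter than [w] but are not structural subterms. *)
Fixpoint lbrack_rec n w :=
  if n is n'.+1 then
    if w is [:: x] then u x
    else br (lbrack_rec n' (lfac w)) (lbrack_rec n' (rfac w))
  else 0.

Definition lbrack w := lbrack_rec (size w) w.

Lemma size_fac w : (size (lfac w) + size (rfac w))%N = size w.
Proof. by rewrite -size_cat -fac_cat. Qed.

Lemma size_lfac w : (1 < size w)%N -> (size (lfac w) < size w)%N.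
Proof.
move=> sz; rewrite -(size_fac w) -[X in (X < _)%N]addn0 ltn_add2l lt0n size_eq0.
exact/eqP/rfac_neq0.
Qed.

Lemma size_rfac w : (1 < size w)%N -> (size (rfac w) < size w)%N.
Proof.
move=> sz; rewrite -(size_fac w) -[X in (X < _)%N]add0n ltn_add2r lt0n size_eq0.
exact/eqP/lfac_neq0.
Qed.

Lemma lbrack_recS n w : (1 < size w)%N ->
  lbrack_rec n.+1 w = br (lbrack_rec n (lfac w)) (lbrack_rec n (rfac w)).
Proof. by case: w => [|x [|y s]]. Qed.

Lemma lbrack_rec_indep n m w : w <> [::] -> (size w <= n)%N -> (size w <= m)%N ->
  lbrack_rec n w = lbrack_rec m w.
Proof.
elim: n m w => [|n IH] [|m] w w0; try by case: w w0.
move=> wn wm; have [sz|] := ltnP 1 (size w); last by case: w w0 wn wm => [|x []].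
have szl := size_lfac sz; have szr := size_rfac sz.
rewrite !lbrack_recS //; congr br; apply: IH.
- exact: lfac_neq0.
- by rewrite -ltnS (leq_trans szl).
- by rewrite -ltnS (leq_trans szl).
- exact: rfac_neq0.
- by rewrite -ltnS (leq_trans szr).
- by rewrite -ltnS (leq_trans szr).
Qed.

Lemma lbrack1 (i : T) : lbrack [:: i] = u i. Proof. by []. Qed.

Lemma lbrackE w : (1 < size w)%N -> lbrack w = br (lbrack (lfac w)) (lbrack (rfac w)).
Proof.
move=> sz; have szl := size_lfac sz; have szr := size_rfac sz.
rewrite {1}/lbrack -[size w]prednK ?(ltnW sz) // lbrack_recS //.
have [l0 r0] := (lfac_neq0 sz, rfac_neq0 sz).
by congr br; apply: lbrack_rec_indep => //; rewrite -ltnS prednK // ltnW.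
Qed.

(** Turns the downward induction on the rearrangements of a word into an induction on natural
    numbers. *)
Definition ngreater w := count (ltw w) (permutations w).

Lemma ngreater_lt w w' : perm_eq w' w -> ltw w w' -> (ngreater w' < ngreater w)%N.
Proof.
move=> pw ww'; rewrite /ngreater.
have /permP -> : perm_eq (permutations w') (permutations w) by apply: perm_permutations.
have s := count_predUI (ltw w') (pred1 w') (permutations w).
have w's : (0 < count_mem w' (permutations w))%N by rewrite -has_count has_pred1 mem_permutations.
apply: (@leq_trans (count (ltw w') (permutations w) + count_mem w' (permutations w))%N).
  by rewrite -addn1 leq_add2l.
rewrite -s [X in (_ + X)%N](_ : _ = 0%N) ?addn0; last first.
  apply/eqP; rewrite -leqn0 leqNgt -has_count; apply/hasPn => v _ /=.
  by apply/negP=> /andP[/[swap] /eqP ->]; rewrite ltww.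
by apply: sub_count => v /= /orP[|/eqP->//]; apply: ltw_trans.
Qed.

Definition lyndon_brackets (P : seq T -> Prop) : L -> Prop :=
  fun x => exists2 l, lyndon l /\ P l & x = lbrack l.

Lemma lyndon_bracketsW (P P' : seq T -> Prop) x : (forall l, P l -> P' l) ->
  zspan (lyndon_brackets P) x -> zspan (lyndon_brackets P') x.
Proof.
move=> PP'; apply: zspan_bind => _ [l [Ll Pl] ->]; apply: zspan_gen.
by exists l => //; split=> //; apply: PP'.
Qed.

Let above a b l := perm_eq l (a ++ b) /\ lew (a ++ b) l.

(* Induction on the length, then downwards on the word [a ++ b] among its
   rearrangements, then on the length of [a]. *)
Lemma br_lbrack a b : lyndon a -> lyndon b -> ltw a b ->
  zspan (lyndon_brackets (above a b)) (br (lbrack a) (lbrack b)).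
Proof.
have [N] := ubnP (size (a ++ b)).
have [K] := ubnP (ngreater (a ++ b)).
have [A] := ubnP (size a).
elim: N K A a b => // N IHN; elim=> // K IHK; elim=> // A IHA a b.
rewrite !ltnS => szA szK szN La Lb ab.
(* If (a, b) is the standard factorization of a b, the bracket is itself a Lyndon bracket. *)
have [std|] := boolP ((1 < size a)%N ==> lew b (rfac a)).
  have rE : rfac (a ++ b) = b by apply: rfac_cat => //; apply/implyP.
  have lE : lfac (a ++ b) = a by apply: lfac_eq rE.
  have sz : (1 < size (a ++ b))%N.
    move: (lyndon_neq0 La) (lyndon_neq0 Lb); rewrite size_cat.
    by case: (a) => // x a' _; case: (b) => // y b' _; rewrite /= addnS.
  apply: zspan_gen; exists (a ++ b); last by rewrite [RHS]lbrackE // lE rE.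
  by split; [apply: lyndon_cat | split; [|apply: leww]].
rewrite negb_imply -ltwNge => /andP[sza nb].
have Lm := lfac_lyndon La sza; have Ln := rfac_lyndon sza.
have mn := lfac_lt_rfac La sza; have szm := size_lfac sza; have szn := size_rfac sza.
have m0 := lfac_neq0 sza; have n0 := rfac_neq0 sza.
(* Otherwise a = m n with n < b, and the Jacobi identity gives [[m, n], b] = [m, [n, b]] - [n,
   [m, b]]. *)
have ea := fac_cat a; rewrite (lbrackE sza) br_jacobi.
set m := lfac a in Lm mn szm m0 ea *; set n := rfac a in nb Ln mn szn n0 ea *.
have mb : ltw m b := ltw_trans mn nb.
have IHb c : lyndon c -> ltw c b -> (size c < size a)%N ->
    zspan (lyndon_brackets (above c b)) (br (lbrack c) (lbrack b)).
  move=> Lc cb szc; apply: (IHN (ngreater (c ++ b)).+1 (size c).+1) => //.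
  by apply: leq_trans szN; rewrite !size_cat ltn_add2r.
have big c l : lyndon c -> lyndon l -> ltw c l -> perm_eq (c ++ l) (a ++ b) ->
    ltw (a ++ b) (c ++ l) ->
    zspan (lyndon_brackets (above a b)) (br (lbrack c) (lbrack l)).
  move=> Lc Ll cl pcl lt.
  apply: (@lyndon_bracketsW (above c l)) => [v [pv lv]|].
    split; first exact: perm_trans pcl.
    by apply: lew_trans lv; apply: ltwW.
  apply: (IHK (size c).+1) => //; first by apply: leq_trans szK; apply: ngreater_lt.
  by rewrite (perm_size pcl).
apply: zspanB.
- apply: (@zspan_br (fun x => x = lbrack m) (lyndon_brackets (above n b)));
    [|by apply: zspan_gen | exact: IHb].
  move=> _ _ -> [l [Ll [pl lel]] ->].
  have pml : perm_eq (m ++ l) (a ++ b) by rewrite ea -catA perm_cat2l.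
  have ml : ltw m l.
    by apply: ltw_lew_trans lel; apply: ltw_trans mn _; apply/ltw_prefix/eqP/lyndon_neq0.
  move: lel; rewrite /lew => /orP[/eqP el|lt]; last first.
    by apply: big => //; rewrite ea -catA ltw_catl.
  (* The word a b is unchanged here, but the left factor m is shorter than a: this is the innermost
     induction. *)
  have eml : m ++ l = a ++ b by rewrite -el catA -ea.
  have := IHA m l; rewrite /above eml; apply=> //; first exact: leq_trans szA.
- apply: (@zspan_br (fun x => x = lbrack n) (lyndon_brackets (above m b)));
    [|by apply: zspan_gen | exact: IHb].
  move=> _ _ -> [l [Ll [pl lel]] ->].
  have pln : perm_eq (l ++ n) (a ++ b).
    apply: perm_trans (perm_cat pl (perm_refl n)) _.
    by rewrite ea -!catA perm_cat2l perm_catC.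
  have pnl : perm_eq (n ++ l) (a ++ b) by rewrite perm_catC.
  case/or3P: (ltw_total n l) => [nl|/eqP->|ln].
  + by apply: big => //; rewrite ea -catA; apply: lyndon_suffix => //; rewrite -ea.
  + by rewrite brxx; apply: zspan0.
  rewrite brC; apply/zspanN/big => //.
  (* From n b < b < b n follows a b = m n b < m b n, and m b n <= l n since l >= m b. *)
  apply: (@ltw_lew_trans _ _ ((m ++ b) ++ n)).
    rewrite ea -!catA ltw_catl; apply: ltw_trans (lyndon_cat_lt Ln Lb nb) _.
    exact/ltw_prefix/eqP.
  case/orP: lel => [/eqP->|lt]; first exact: leww.
  by apply/ltwW/ltw_cat => //; rewrite (perm_size pl).
Qed.

Theorem lie_gen_lyndon x :
  lie_gen (fun y => exists i, y = u i) x -> zspan (lyndon_brackets (fun=> True)) x.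
Proof.
elim=> [|_ [i ->]|a b _ ? _ ?|a b _ Sa _ Sb].
- exact: zspan0.
- by apply: zspan_gen; exists [:: i]; rewrite ?lbrack1 //; split=> //; apply: lyndon1.
- exact: zspanB.
apply: zspan_br Sa Sb => _ _ [k [Lk _] ->] [l [Ll _] ->].
case/or3P: (ltw_total k l) => [kl|/eqP->|lk].
- by apply: lyndon_bracketsW (br_lbrack Lk Ll kl).
- by rewrite brxx; apply: zspan0.
- by rewrite brC; apply: zspanN; apply: lyndon_bracketsW (br_lbrack Ll Lk lk).
Qed.

Lemma zspan_lyndonP x : zspan (lyndon_brackets (fun=> True)) x ->
  exists (s : seq (seq T)) (c : seq T -> int),
    [/\ uniq s, all (@lyndon T) s & x = \sum_(l <- s) lbrack l *~ c l].
Proof.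
elim=> [|_ [l [Ll _] ->]|y z _ [s [c [us Ls ->]]] _ [t [d [ut Lt ->]]]].
- by exists [::], (fun=> 0); rewrite big_nil.
- by exists [:: l], (fun=> 1); rewrite big_seq1 /= Ll.
(* Both coefficient families are extended by zero to the union of the two supports. *)
pose c' l := if l \in s then c l else 0; pose d' l := if l \in t then d l else 0.
have E (r r' : seq (seq T)) (e e' : seq T -> int) : uniq r -> uniq r' -> {subset r <= r'} ->
    (forall l, e' l = if l \in r then e l else 0) ->
    \sum_(l <- r) lbrack l *~ e l = \sum_(l <- r') lbrack l *~ e' l.
  move=> ur ur' rr' He.
  rewrite [RHS](bigID (mem r)) /= [X in _ = _ + X]big1 => [|l /negPf nr]; last by rewrite He nr.
  rewrite addr0 -[RHS]big_filter; rewrite (perm_big [seq l <- r' | l \in r]) /=.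
    by rewrite big_seq [RHS]big_seq; apply: eq_bigr => l; rewrite mem_filter He => /andP[->].
  apply: uniq_perm => // [|l]; first exact: filter_uniq.
  by rewrite mem_filter; case: (boolP (l \in r)) => // /rr' ->.
exists (undup (s ++ t)), (fun l => c' l - d' l); split.
- exact: undup_uniq.
- apply/allP=> l; rewrite mem_undup mem_cat => /orP[/(allP Ls)|/(allP Lt)] //.
- rewrite (E s (undup (s ++ t)) c c') ?undup_uniq //; last first.
    by move=> l; rewrite mem_undup mem_cat => ->.
  rewrite (E t (undup (s ++ t)) d d') ?undup_uniq //; last first.
    by move=> l; rewrite mem_undup mem_cat orbC => ->.
  by rewrite -sumrB; apply: eq_bigr => l _; rewrite mulrzBr.
Qed.

End Lyndon.
End LieRing.

(** * Endomorphisms and formal power series *)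

Record endo (V : zmodType) :=
  Endo {endo_fun :> V -> V; endoB : forall x y, endo_fun (x - y) = endo_fun x - endo_fun y}.

Section EndoRing.
Variable V : zmodType.
Implicit Types f g h : endo V.

Lemma endoP f g : (forall x, f x = g x) -> f = g.
Proof.
case: f g => [f fB] [g gB] /= /funext e; rewrite e in fB *; congr Endo.
exact: Prop_irrelevance.
Qed.

Lemma endo0 f : f 0 = 0. Proof. by rewrite -{1}(subrr 0) endoB subrr. Qed.
Lemma endoN f x : f (- x) = - f x.
Proof. by rewrite -[- x]sub0r endoB endo0 sub0r. Qed.
Lemma endoD f x y : f (x + y) = f x + f y.
Proof. by rewrite -{1}[y]opprK endoB endoN opprK. Qed.

Fact endo_zero_subproof (x y : V) : 0 = 0 - 0 :> V.
Proof. by rewrite subrr. Qed.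
Fact endo_opp_subproof f x y : - f (x - y) = - f x - - f y.
Proof. by rewrite endoB opprD. Qed.
Fact endo_add_subproof f g x y : f (x - y) + g (x - y) = f x + g x - (f y + g y).
Proof. by rewrite !endoB opprD addrACA. Qed.
Fact endo_mul_subproof f g x y : f (g (x - y)) = f (g x) - f (g y).
Proof. by rewrite !endoB. Qed.

Definition endo_zero := Endo endo_zero_subproof.
Definition endo_opp f := Endo (endo_opp_subproof f).
Definition endo_add f g := Endo (endo_add_subproof f g).
Definition endo_one := @Endo V id (fun x y => erefl).
Definition endo_mul f g := Endo (endo_mul_subproof f g).

HB.instance Definition _ := gen_eqMixin (endo V).
HB.instance Definition _ := gen_choiceMixin (endo V).

Fact endo_addA : associative endo_add. Proof. by move=> f g h; apply: endoP => x /=; rewrite addrA. Qed.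
Fact endo_addC : commutative endo_add. Proof. by move=> f g; apply: endoP => x /=; rewrite addrC. Qed.
Fact endo_add0 : left_id endo_zero endo_add. Proof. by move=> f; apply: endoP => x /=; rewrite add0r. Qed.
Fact endo_addN : left_inverse endo_zero endo_opp endo_add.
Proof. by move=> f; apply: endoP => x /=; rewrite addNr. Qed.
Fact endo_mulA : associative endo_mul. Proof. by move=> f g h; apply: endoP. Qed.
Fact endo_mul1 : left_id endo_one endo_mul. Proof. by move=> f; apply: endoP. Qed.
Fact endo_mulr1 : right_id endo_one endo_mul. Proof. by move=> f; apply: endoP. Qed.
Fact endo_mulDl : left_distributive endo_mul endo_add. Proof. by move=> f g h; apply: endoP. Qed.
Fact endo_mulDr : right_distributive endo_mul endo_add.
Proof. by move=> f g h; apply: endoP => x /=; rewrite endoD. Qed.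

HB.instance Definition _ := GRing.isPzRing.Build (endo V)
  endo_addA endo_addC endo_add0 endo_addN endo_mulA endo_mul1 endo_mulr1 endo_mulDl endo_mulDr.

Lemma endo_addE f g x : (f + g) x = f x + g x. Proof. by []. Qed.
Lemma endo_oppE f x : (- f) x = - f x. Proof. by []. Qed.
Lemma endo_mulE f g x : (f * g) x = f (g x). Proof. by []. Qed.
Lemma endo_sumE (I : Type) (r : seq I) (P : pred I) (F : I -> endo V) x :
  (\sum_(i <- r | P i) F i) x = \sum_(i <- r | P i) F i x.
Proof. by elim/big_rec2: _ => // i y z _ <-. Qed.
Lemma endo_mulzE f x (n : int) : (f *~ n) x = f x *~ n.
Proof.
have Hn m : (f *+ m) x = f x *+ m by elim: m => // m IH; rewrite !mulrS endo_addE IH.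
by case: n => n; rewrite ?NegzE ?mulrNz -?pmulrn ?endo_oppE Hn.
Qed.

End EndoRing.

(** * Formal power series in a central variable t *)

Definition series (R : pzRingType) := nat -> R.

Section Series.
Variable R : pzRingType.
Implicit Types s t r z : series R.

HB.instance Definition _ := GRing.Zmodule.copy (series R) (nat -> R).

Definition series_one : series R := fun n => (n == 0%N)%:R.
Definition series_mul s t : series R := fun n => \sum_(i < n.+1) s i * t (n - i)%N.

Lemma series_mul_rev s t n : series_mul s t n = \sum_(i < n.+1) s (n - i)%N * t i.
Proof.
rewrite /series_mul (reindex_inj rev_ord_inj) /=.
by apply: eq_bigr => j _; rewrite subSS subKn // -ltnS.
Qed.

Fact series_mulA : associative series_mul.
Proof.
move=> p q r; apply: funext => i; rewrite [RHS]series_mul_rev [LHS]/series_mul.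
pose coef3 j k := p j * (q (i - j - k)%N * r k).
transitivity (\sum_(j < i.+1) \sum_(k < i.+1 | (k <= i - j)%N) coef3 j k).
  apply: eq_bigr => /= j _; rewrite series_mul_rev big_distrr /=.
  by rewrite (big_ord_narrow_leq (leq_subr _ _)).
rewrite (exchange_big_dep predT) //=; apply: eq_bigr => k _.
transitivity (\sum_(j < i.+1 | (j <= i - k)%N) coef3 j k).
  apply: eq_bigl => j; rewrite -ltnS -(ltnS j) -!subSn ?leq_ord //.
  by rewrite -subn_gt0 -(subn_gt0 j) -!subnDA addnC.
rewrite (big_ord_narrow_leq (leq_subr _ _)) /series_mul big_distrl /=.
by apply: eq_bigr => j _; rewrite /coef3 -!subnDA addnC mulrA.
Qed.

Fact series_mul1 : left_id series_one series_mul.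
Proof.
move=> s; apply: funext => n; rewrite /series_mul big_ord_recl subn0 mul1r.
by rewrite big1 ?addr0 // => i _; rewrite mul0r.
Qed.

Fact series_mulr1 : right_id series_one series_mul.
Proof.
move=> s; apply: funext => n; rewrite series_mul_rev big_ord_recl subn0 mulr1.
by rewrite big1 ?addr0 // => i _; rewrite mulr0.
Qed.

Fact series_mulDl : left_distributive series_mul +%R.
Proof.
move=> s t r; apply: funext => n.
rewrite -[RHS]/(series_mul s r n + series_mul t r n) /series_mul -big_split /=.
by apply: eq_bigr => i _; rewrite mulrDl.
Qed.

Fact series_mulDr : right_distributive series_mul +%R.
Proof.
move=> s t r; apply: funext => n.
rewrite -[RHS]/(series_mul s t n + series_mul s r n) /series_mul -big_split /=.
by apply: eq_bigr => i _; rewrite mulrDr.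
Qed.

HB.instance Definition _ := GRing.Zmodule_isPzRing.Build (series R)
  series_mulA series_mul1 series_mulr1 series_mulDl series_mulDr.

Lemma seriesM s t n : (s * t) n = \sum_(i < n.+1) s i * t (n - i)%N. Proof. by []. Qed.
Lemma seriesB s t n : (s - t) n = s n - t n. Proof. by []. Qed.
Lemma seriesD s t n : (s + t) n = s n + t n. Proof. by []. Qed.
Lemma series1 n : (1 : series R) n = (n == 0%N)%:R. Proof. by []. Qed.
Lemma series_sum (I : Type) (r : seq I) (P : pred I) (F : I -> series R) n :
  (\sum_(i <- r | P i) F i) n = \sum_(i <- r | P i) F i n.
Proof. by elim/big_rec2: _ => // i y z _ <-. Qed.

Definition order_ge k s := forall i, (i < k)%N -> s i = 0.

Lemma order_geM j k s t : order_ge j s -> order_ge k t ->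
  order_ge (j + k) (s * t) /\ (s * t) (j + k)%N = s j * t k.
Proof.
move=> sj tk; have tj i n : (i < j)%N -> s i * t n = 0 by move=> /sj ->; rewrite mul0r.
have st i n : (n < k)%N -> s i * t n = 0 by move=> /tk ->; rewrite mulr0.
split.
  move=> n nlt; rewrite seriesM big1 // => i _; have [/tj//|ji] := ltnP i j.
  by apply: st; rewrite -(ltn_add2l i) subnKC ?leq_ord // (leq_trans nlt) // leq_add2r.
rewrite seriesM; have jlt : (j < (j + k).+1)%N by rewrite ltnS leq_addr.
rewrite (bigD1 (Ordinal jlt)) //= addKn big1 ?addr0 // => i ne.
case: (ltngtP i j) => [/tj//|ji|e]; last by rewrite -val_eqE /= e eqxx in ne.
by apply: st; rewrite -(ltn_add2l i) subnKC ?leq_ord // ltn_add2r.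
Qed.

(** s = 1 + t^(d+1) D + higher terms, the index being shifted as in [lcs]. D may be zero. *)
Definition lead d s D := order_ge d.+1 (s - 1) /\ s d.+1 = D.

Lemma leadE d s D : lead d s D -> (s - 1) d.+1 = D.
Proof. by case=> _ <-; rewrite seriesB series1 subr0. Qed.

Lemma order_geB k s t : order_ge k s -> order_ge k t -> order_ge k (s - t).
Proof. by move=> sk tk i lt; rewrite seriesB sk // tk // subr0. Qed.

Lemma order_ge0 s : order_ge 0 s. Proof. by []. Qed.

(** s t^-1 - 1 = (s - t) t^-1, and t^-1 has constant term 1. *)
Lemma lead_divr d s t (t' : series R) D E : t * t' = 1 -> t' 0%N = 1 ->
  lead d s D -> lead d t E -> lead d (s * t') (D - E).
Proof.
move=> tt' t'0 [sD <-] [tE <-].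
have e : s * t' - 1 = (s - t) * t' by rewrite mulrBl tt'.
have st : order_ge d.+1 (s - t).
  by have := order_geB sD tE; rewrite opprB addrA subrK.
have := order_geM st (order_ge0 t'); rewrite addn0 t'0 mulr1 -e => -[v l]; split=> //.
by move: l; rewrite !seriesB series1 subr0.
Qed.

(** With z = (t s)^-1 one has z s t - 1 = z (s t - t s), and s t - t s = (s - 1)(t - 1) - (t - 1)(s
    - 1), so leading coefficients multiply. *)
Lemma lead_comm d e s t z D E : z 0%N = 1 -> z * (t * s) = 1 ->
  lead d s D -> lead e t E -> lead (d + e).+1 (z * (s * t)) (D * E - E * D).
Proof.
move=> z0 zts [sD Dd] [tE Ee].
have [v1 l1] := order_geM sD tE; have [v2 l2] := order_geM tE sD.
rewrite addnC in v2 l2; rewrite !(leadE (conj sD Dd)) !(leadE (conj tE Ee)) in l1 l2.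
have H : z * (s * t) - 1 = z * ((s - 1) * (t - 1) - (t - 1) * (s - 1)).
  rewrite -{1}zts -mulrBr; congr (z * _).
  rewrite !mulrBl !mulrBr !mulr1 !mul1r -[s * t - s - _]addrA -[t * s - t - _]addrA.
  by rewrite -!opprD [t + (s - 1)]addrCA opprB subrKA.
have [v l] := order_geM (order_ge0 z) (order_geB v1 v2).
rewrite -H add0n in v l; rewrite z0 mul1r seriesB l1 l2 addSn addnS in l.
split; first by rewrite -addnS -addSn.
by move: l; rewrite seriesB series1 subr0.
Qed.

End Series.

(** * Unipotent power series and triangularity *)

Record unipotent (R : pzRingType) := Unipotent {useries :> series R; useries0 : useries 0%N = 1}.

Section UnipotentGroup.
Variable R : pzRingType.
Implicit Types s t : series R.
Implicit Types x y z : unipotent R.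

Lemma unipotentP x y : useries x = useries y -> x = y.
Proof.
case: x y => [s s0] [t t0] /= e; rewrite e in s0 *; congr Unipotent.
exact: Prop_irrelevance.
Qed.

Lemma seriesM0 s t : s 0%N = 1 -> t 0%N = 1 -> (s * t) 0%N = 1.
Proof. by move=> s0 t0; rewrite seriesM big_ord1 s0 t0 mulr1. Qed.

(** Geometric series for the inverse: (1 - s)^k has order at least k, so the n-th coefficient only
    involves k <= n. *)
Definition series_inv s : series R := fun n => (\sum_(k < n.+1) (1 - s) ^+ k) n.

Lemma series_inv0 s : series_inv s 0%N = 1.
Proof. by rewrite /series_inv big_ord1 expr0. Qed.

Lemma order_geX s k : s 0%N = 0 -> order_ge k (s ^+ k).
Proof.
move=> s0; elim: k => [|k IH]; first exact: order_ge0.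
have s1 : order_ge 1 s by case.
by rewrite exprS -add1n; have [] := order_geM s1 IH.
Qed.

Lemma series_mulV s : s 0%N = 1 -> s * series_inv s = 1.
Proof.
move=> s0; apply: funext => n; set u := 1 - s.
have u0 : u 0%N = 0 by rewrite /u seriesB s0 subrr.
have inv_trunc m : (m <= n)%N -> series_inv s m = (\sum_(k < n.+1) u ^+ k) m.
  move=> mn; rewrite /series_inv !series_sum; have le : (m.+1 <= n.+1)%N by [].
  rewrite (big_ord_widen _ (fun k => (u ^+ k) m) le) [RHS](bigID (fun k : 'I__ => (k < m.+1)%N)) /=.
  rewrite [X in _ = _ + X]big1 ?addr0 // => k; rewrite -leqNgt => mk.
  exact: (order_geX u0).
transitivity ((s * \sum_(k < n.+1) u ^+ k) n).
  rewrite !seriesM; apply: eq_bigr => i _; rewrite inv_trunc //; exact: leq_subr.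
have -> : s = - (u - 1) by rewrite /u opprB opprB addrC subrK.
rewrite mulNr -subrX1 opprB seriesB (order_geX u0) ?subr0 //.
Qed.

Definition unip_one := @Unipotent R 1 erefl.
Definition unip_mul x y := @Unipotent R (useries x * useries y) (seriesM0 (useries0 x) (useries0 y)).
Definition unip_inv x := @Unipotent R (series_inv x) (series_inv0 x).

HB.instance Definition _ := gen_eqMixin (unipotent R).
HB.instance Definition _ := gen_choiceMixin (unipotent R).

Fact unip_mulA : associative unip_mul.
Proof. by move=> x y z; apply: unipotentP; rewrite /= mulrA. Qed.
Fact unip_mul1 : left_id unip_one unip_mul.
Proof. by move=> x; apply: unipotentP; rewrite /= mul1r. Qed.
Fact unip_mulr1 : right_id unip_one unip_mul.
Proof. by move=> x; apply: unipotentP; rewrite /= mulr1. Qed.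
Fact unip_mulV : right_inverse unip_one unip_inv unip_mul.
Proof. by move=> x; apply: unipotentP; apply/series_mulV/useries0. Qed.
Fact unip_Vmul : left_inverse unip_one unip_inv unip_mul.
Proof.
move=> x; have e : unip_inv (unip_inv x) = x.
  by rewrite -[LHS]unip_mul1 -(unip_mulV x) -unip_mulA unip_mulV unip_mulr1.
by rewrite -{2}e unip_mulV.
Qed.

HB.instance Definition _ := isGroup.Build (unipotent R)
  unip_mulA unip_mul1 unip_mulr1 unip_Vmul unip_mulV.

Lemma unipM x y : useries (x * y)%g = useries x * useries y. Proof. by []. Qed.
Lemma unip1 : useries (1%g : unipotent R) = 1. Proof. by []. Qed.
Lemma unipVK x : useries x * useries (x^-1)%g = 1.
Proof. by rewrite -unipM mulgV. Qed.
Lemma unipKV x : useries (x^-1)%g * useries x = 1.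
Proof. by rewrite -unipM mulVg. Qed.

Lemma lead_unip_div d x y D E :
  lead d x D -> lead d y E -> lead d (x * y^-1)%g (D - E).
Proof. exact/lead_divr/useries0/unipVK. Qed.

Lemma lead_unip_comm d e x y D E :
  lead d x D -> lead e y E -> lead (d + e).+1 [~ x, y]%g (D * E - E * D).
Proof.
move=> xD yE; have -> : [~ x, y]%g = ((y * x)^-1 * (x * y))%g by rewrite invgM -!mulgA.
rewrite !unipM; apply: lead_comm => //; first exact: useries0.
by rewrite -unipM unipKV.
Qed.

Lemma lead_unip1 d : lead d (1%g : unipotent R) 0.
Proof. by split=> //; rewrite unip1 subrr. Qed.

Lemma lead0 x : lead 0 x (useries x 1%N).
Proof. by split=> // -[|//] _; rewrite seriesB useries0 subrr. Qed.

End UnipotentGroup.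

Section LbrackMorphism.
Variables (L L' : zmodType) (br : L -> L -> L) (br' : L' -> L' -> L') (phi : L -> L').
Hypothesis phiM : forall x y, phi (br x y) = br' (phi x) (phi y).
Hypothesis phi0 : phi 0 = 0.

Lemma lbrack_morph (T : countType) (u : T -> L) w :
  phi (lbrack br u w) = lbrack br' (phi \o u) w.
Proof.
have H n : forall v, phi (lbrack_rec br u n v) = lbrack_rec br' (phi \o u) n v.
  by elim: n => //= n IH [|x [|y v]] //; rewrite phiM !IH.
exact: H.
Qed.

End LbrackMorphism.

Lemma ltw_min (T : countType) (s : seq (seq T)) : s <> [::] ->
  exists2 l, l \in s & forall l', l' \in s -> ~~ ltw l' l.
Proof.
elim: s => // l s IH _; have [->|/eqP/IH [m ms mP]] := eqVneq s [::].
  by exists l => [|l']; rewrite inE ?eqxx // => /eqP ->; rewrite ltww.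
have [lm|nlm] := boolP (ltw l m).
  exists l => [|l']; rewrite inE ?eqxx // => /orP[/eqP->|/mP]; first by rewrite ltww.
  by apply: contra => l'l; apply: ltw_trans lm.
exists m => [|l']; rewrite inE ?ms ?orbT // => /orP[/eqP->|/mP] //.
Qed.

Lemma fctBE (X : Type) (V : zmodType) (f g : X -> V) x : (f - g) x = f x - g x.
Proof. by []. Qed.

Lemma fct_mulrzE (X : Type) (V : zmodType) (f : X -> V) (n : int) x : (f *~ n) x = f x *~ n.
Proof.
have Hn m : (f *+ m) x = f x *+ m by elim: m => // m IH; rewrite !mulrS -IH.
by case: n => n; rewrite ?NegzE ?mulrNz -?pmulrn ?opprfctE Hn.
Qed.

(** * Linear independence of Lyndon brackets of operators *)

Section Triangularity.
Variables (X : Type) (T : countType).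
Let Phi : zmodType := (X -> int).
Variables (d : T -> endo Phi) (p : seq T -> X).
(** The operators are prescribed only at the points [p w]. This covers both the operators [strip e],
    with [p] the identity, and the degree one symbols of a1 and a2, with [p w] the one-letter word
    on [LZ w]. *)
Hypothesis dE : forall i (f : Phi) w, d i f (p w) = f (p (i :: w)).
Implicit Types (f : Phi) (l u v w : seq T).

(* The opposite of the commutator, because words are read in the order in which
   the operators [d i] consume letters. *)
Definition opp_comm (R : pzRingType) (a b : R) := b * a - a * b.

(** Write l = m r in standard factorization. One product of the two brackets evaluates f at m r v,
    the other at r m v, and r m > l, where f vanishes. Requiring this for all larger words of the
    same length makes the hypothesis pass to the factors. *)
Lemma lbrack_lead l f v : lyndon l ->
  (forall u, size u = size l -> ltw l u -> f (p (u ++ v)) = 0) ->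
  lbrack (@opp_comm _) d l f (p v) = f (p (l ++ v)).
Proof.
have [n] := ubnP (size l); elim: n l f v => // n IH l f v; rewrite ltnS => szn Ll fv.
have [sz|sz] := ltnP 1 (size l); last first.
  case: l Ll sz {szn fv} => [/lyndon_neq0//|x [|//]] _ _.
  by rewrite lbrack1 dE.
have Lm := lfac_lyndon Ll sz; have Ln := rfac_lyndon sz.
have szm : (size (lfac l) < n)%N := leq_trans (size_lfac sz) szn.
have szr : (size (rfac l) < n)%N := leq_trans (size_rfac sz) szn.
have ln := fac_lt Ll sz; have := fac_cat l.
rewrite lbrackE // /opp_comm endo_addE endo_oppE !endo_mulE fctBE.
move: (lfac l) (rfac l) Lm Ln szm szr ln => m r Lm Lr szm szr ln e.
have r0 := lyndon_neq0 Lr; have m0 := lyndon_neq0 Lm.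
have vanish u u' : size u = size r -> size u' = size m -> lew r u ->
    f (p (u ++ u' ++ v)) = 0.
  move=> su su' ru; rewrite catA; apply: fv; first by rewrite e !size_cat su su' addnC.
  rewrite e; case/orP: ru => [/eqP<-|ru].
    by rewrite -[m ++ r]cats0 -catA; apply: lyndon_suffix => //; rewrite -e.
  rewrite -[m ++ r]cats0; apply: ltw_cat; last by rewrite size_cat su leq_addl.
  by rewrite -e; apply: ltw_trans ln ru.
rewrite [X in _ - X](_ : _ = 0) ?subr0; last first.
  rewrite IH //; first by rewrite IH // => [|u su ru]; apply: vanish => //; [apply: leww|apply: ltwW].
  move=> u su mu; rewrite IH // => [|u' su' ru']; apply: vanish => //; [exact: leww|exact: ltwW].
rewrite IH // => [|u su ru].
  rewrite IH // => [|u su mu]; first by rewrite e catA.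
  by rewrite catA fv ?e ?size_cat ?su //; apply: ltw_cat; rewrite ?su.
rewrite IH // => [|u' su' mu'].
  by rewrite catA fv ?e ?size_cat ?su // ltw_catl.
by rewrite catA fv ?e ?size_cat ?su ?su' //; apply: ltw_cat; rewrite ?su'.
Qed.

Hypothesis pI : injective p.

(** Take the smallest word with nonzero coefficient and test against the indicator of its point: by
    [lbrack_lead] only that word contributes. Asking only for test functions supported on the image
    of [p] leaves room for an operator invisible to them. *)
Lemma lbrack_indep (s : seq (seq T)) (c : seq T -> int) :
  uniq s -> all (@lyndon T) s ->
  (forall f, (forall x, (forall w, x <> p w) -> f x = 0) ->
     (\sum_(l <- s) lbrack (@opp_comm _) d l *~ c l) f (p [::]) = 0) ->
  forall l, l \in s -> c l = 0.
Proof.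
move=> us Ls H l ls; apply/eqP/negPn/negP => cl.
have [|l0] := @ltw_min _ [seq l <- s | c l != 0].
  move=> e; have : l \in [seq l <- s | c l != 0] by rewrite mem_filter cl.
  by rewrite e.
rewrite mem_filter => /andP[c0 l0s] l0P; case/negP: c0.
pose f : Phi := fun x => (`[< x = p l0 >] : nat)%:Z.
have fp w : f (p w) = (w == l0)%:Z.
  by rewrite /f; congr (Posz (nat_of_bool _)); apply/asboolP/eqP => [/pI|->].
have f0 x : (forall w, x <> p w) -> f x = 0 by rewrite /f; case: asboolP => // -> /(_ l0).
have := H f f0; rewrite endo_sumE fct_sumE (bigD1_seq l0) //= big1_seq => [|k /andP[kl0 ks]].
  rewrite endo_mulzE fct_mulrzE lbrack_lead ?(allP Ls) // => [|u _ lu]; last first.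
    by rewrite cats0 fp; case: eqP lu => // ->; rewrite ltww.
  by rewrite cats0 fp eqxx addr0 intz => ->.
have [->|ck] := eqVneq (c k) 0; first by rewrite mulr0z.
have nkl : ltw l0 k.
  have /l0P : k \in [seq l <- s | c l != 0] by rewrite mem_filter ck.
  by rewrite ltwNge negbK /lew eq_sym (negPf kl0).
rewrite endo_mulzE fct_mulrzE lbrack_lead ?(allP Ls) // => [|u _ ku].
  by rewrite cats0 fp (negPf kl0) mul0rz.
rewrite cats0 fp; case: eqP ku => // -> /(ltw_trans nkl); by rewrite ltww.
Qed.

End Triangularity.

(** * The representation *)

Section ShiftSeries.
Variable R : pzRingType.
Implicit Types s t : series R.

Definition cst_series (D : R) : series R := fun n => if n is 0%N then D else 0.
Definition shift_series s : series R := fun n => if n is m.+1 then s m else 0.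

Lemma shift_seriesM s t : shift_series s * t = shift_series (s * t).
Proof.
apply: funext => -[|n]; rewrite seriesM big_ord_recl mul0r ?big_ord0 ?addr0 // add0r.
by apply: eq_bigr => i _.
Qed.

Lemma series_shiftM s t : s * shift_series t = shift_series (s * t).
Proof.
apply: funext => -[|n]; first by rewrite seriesM big_ord1 mulr0.
rewrite seriesM big_ord_recr subnn mulr0 [LHS]addr0.
by apply: eq_bigr => i _; rewrite [widen_ord _ i : nat]/= subSn; last exact: leq_ord.
Qed.

Lemma cst_seriesM D s n : (cst_series D * s) n = D * s n.
Proof.
rewrite seriesM big_ord_recl subn0 big1 ?addr0 // => i _; exact: mul0r.
Qed.

Fact one_shift0 s : (1 + shift_series s) 0%N = 1.
Proof. by rewrite seriesD addr0. Qed.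

Definition one_shift s := Unipotent (one_shift0 s).

Lemma one_shift_conj (x : unipotent R) s :
  (x * one_shift s * x^-1)%g = one_shift (useries x * s * useries x^-1%g).
Proof.
apply: unipotentP.
by rewrite !unipM /= mulrDr mulr1 mulrDl unipVK series_shiftM shift_seriesM.
Qed.

Lemma unip_coef1M (x y : unipotent R) : useries (x * y)%g 1%N = useries x 1%N + useries y 1%N.
Proof.
by rewrite unipM seriesM big_ord_recr big_ord1 /= !useries0 mul1r mulr1 addrC.
Qed.

Lemma unip_coef1V (x : unipotent R) : useries x^-1%g 1%N = - useries x 1%N.
Proof.
by apply/eqP; rewrite -addr_eq0 -unip_coef1M mulVg.
Qed.

(** The commutator is 1, so its t^2 coefficient, which is the commutator of the symbols,
    vanishes. *)
Lemma commute_coef1 (x y : unipotent R) : commute x y ->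
  useries x 1%N * useries y 1%N - useries y 1%N * useries x 1%N = 0.
Proof.
move=> xy; have [_ <-] := lead_unip_comm (lead0 x) (lead0 y).
by have -> : [~ x, y]%g = 1%g; [rewrite commgEl conjgE xy mulKg mulVg|].
Qed.

End ShiftSeries.

(** [LZ w] stands for the iterated bracket of C2 with A1 ([false]) and A2 ([true]), the head of [w]
    being the outermost. *)
Inductive letter := LB1 | LB2 | LC | LZ of seq bool.

Definition letter_code (e : letter) : nat + seq bool :=
  match e with LB1 => inl 0%N | LB2 => inl 1%N | LC => inl 2%N | LZ w => inr w end.
Definition letter_decode (c : nat + seq bool) : letter :=
  match c with inl 0%N => LB1 | inl 1%N => LB2 | inl _ => LC | inr w => LZ w end.
Lemma letter_codeK : cancel letter_code letter_decode. Proof. by case. Qed.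
HB.instance Definition _ := Countable.copy letter (can_type letter_codeK).

Definition wfun : zmodType := (seq letter -> int).

Fact strip_subproof e (f g : wfun) :
  (fun w => (f - g) (e :: w)) = (fun w => f (e :: w)) - (fun w => g (e :: w)) :> wfun.
Proof. by []. Qed.
Definition strip e : endo wfun := Endo (strip_subproof e).

(** * Operators dual to substitutions of letters *)

Section Alpha.
Variable theta : letter -> series (endo wfun).

(** The t^k coefficient at [w] of the operator that fixes the value at the empty word and is
    determined by [strip e] composed with alpha being alpha composed with [theta e]. It is dual to
    substituting [theta e] for each letter e. *)
Fixpoint alpha_val (w : seq letter) (k : nat) (f : wfun) : int :=
  if w is e :: w' then \sum_(i < k.+1) alpha_val w' i (theta e (k - i)%N f)
  else if k is 0%N then f [::] else 0.

Fact alpha_subproof k (f g : wfun) :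
  (fun w => alpha_val w k (f - g)) =
  (fun w => alpha_val w k f) - (fun w => alpha_val w k g) :> wfun.
Proof.
apply: funext => w; rewrite fctBE.
elim: w k f g => [|e w IH] k f g /=; first by case: k; rewrite ?subr0.
by rewrite -sumrB; apply: eq_bigr => i _; rewrite endoB IH.
Qed.

Definition alpha : series (endo wfun) := fun k => Endo (alpha_subproof k).

Lemma strip_alpha e : cst_series (strip e) * alpha = alpha * theta e.
Proof.
apply: funext => n; rewrite cst_seriesM; apply: endoP => f; apply: funext => w.
by rewrite seriesM endo_sumE fct_sumE.
Qed.

Hypothesis theta0 : forall e, theta e 0%N = strip e.

Fact alpha0 : alpha 0%N = 1.
Proof.
apply: endoP => f; apply: funext => w /=.
by elim: w f => //= e w IH f; rewrite big_ord1 IH theta0.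
Qed.

Definition ualpha := Unipotent alpha0.

Definition ustrip e := one_shift (cst_series (strip e)).

Lemma ustrip_alpha e : (ustrip e * ualpha)%g = (ualpha * one_shift (theta e))%g.
Proof.
apply: unipotentP; rewrite !unipM /= mulrDl mulrDr mul1r mulr1.
by rewrite shift_seriesM series_shiftM strip_alpha.
Qed.

Lemma strip_alpha1 e : strip e * alpha 1%N - alpha 1%N * strip e = theta e 1%N.
Proof.
have /(congr1 (fun s : series _ => s 1%N)) := strip_alpha e.
rewrite cst_seriesM seriesM big_ord_recr big_ord1 /= alpha0 theta0 mul1r => ->.
by rewrite addrK.
Qed.

Lemma alpha1_letter e f : alpha 1%N f [:: e] = theta e 1%N f [::].
Proof. by rewrite /= big_ord_recr big_ord1 /= addr0. Qed.

End Alpha.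

Local Notation uB1 := (ustrip LB1).
Local Notation uB2 := (ustrip LB2).
Local Notation uC := (ustrip LC).

Definition sconj (x : unipotent (endo wfun)) e : series (endo wfun) :=
  useries x * cst_series (strip e) * useries x^-1%g.

(** As c2 is free, the action on the letters [LZ w] may be chosen: bracketing [LZ w] with A_i is to
    give the new letter [LZ (i :: w)]. *)
Definition theta_z i w : series (endo wfun) :=
  cst_series (strip (LZ w)) + shift_series (cst_series (strip (LZ (i :: w)))).

(** Forced by the group relations: a1 fixes b1 and conjugates b2 and c1 by b2 c1^-1; likewise, in
    [theta2], a2 fixes b2 and conjugates b1 and c1 by c1^-1 b1. *)
Definition theta1 e := match e with
  | LB1 => cst_series (strip LB1)
  | LB2 => sconj (uB2 * uC^-1)%g LB2
  | LC => sconj (uB2 * uC^-1)%g LC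
  | LZ w => theta_z false w end.

Definition theta2 e := match e with
  | LB1 => sconj (uC^-1 * uB1)%g LB1
  | LB2 => cst_series (strip LB2)
  | LC => sconj (uC^-1 * uB1)%g LC
  | LZ w => theta_z true w end.

Lemma sconj0 x e : sconj x e 0%N = strip e.
Proof.
rewrite /sconj !seriesM big_ord1 subnn seriesM big_ord1 subnn !useries0 /=.
by rewrite mul1r mulr1.
Qed.

Lemma theta10 e : theta1 e 0%N = strip e.
Proof. by case: e => [|||w]; rewrite /= ?sconj0 // /theta_z seriesD addr0. Qed.

Lemma theta20 e : theta2 e 0%N = strip e.
Proof. by case: e => [|||w]; rewrite /= ?sconj0 // /theta_z seriesD addr0. Qed.

Definition uA1 := ualpha theta10.
Definition uA2 := ualpha theta20.

Lemma ustrip_uA1 e : (ustrip e * uA1)%g = (uA1 * one_shift (theta1 e))%g.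
Proof. exact: ustrip_alpha. Qed.

Lemma ustrip_uA2 e : (ustrip e * uA2)%g = (uA2 * one_shift (theta2 e))%g.
Proof. exact: ustrip_alpha. Qed.

Lemma one_shift_sconj x e : one_shift (sconj x e) = (x * ustrip e * x^-1)%g.
Proof. by rewrite one_shift_conj. Qed.

Section ConjugationLemmas.
Variable G : groupType.
Local Open Scope group_scope.

Lemma commute_of_conj (a x : G) : x ^ a = x -> commute x a.
Proof. by move=> xa; rewrite /commute conjgC xa. Qed.

Lemma conj_of_twist (a x y : G) : x * a = a * y -> x ^ a = y.
Proof. by move=> e; rewrite conjgE e mulKg. Qed.

End ConjugationLemmas.

Section Relations.
Local Open Scope group_scope.

Let s1 := uB2 * uC^-1.
Let s2 := uC^-1 * uB1.

Lemma conj_uA1 : [/\ uB1 ^ uA1 = uB1, uB2 ^ uA1 = uB2 ^ s1^-1 & uC ^ uA1 = uC ^ s1^-1].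
Proof.
split; apply: conj_of_twist; rewrite ustrip_uA1; congr (_ * _) => //=;
  by rewrite one_shift_sconj conjgE invgK mulgA.
Qed.

Lemma conj_uA2 : [/\ uB2 ^ uA2 = uB2, uB1 ^ uA2 = uB1 ^ s2^-1 & uC ^ uA2 = uC ^ s2^-1].
Proof.
split; apply: conj_of_twist; rewrite ustrip_uA2; congr (_ * _) => //=;
  by rewrite one_shift_sconj conjgE invgK mulgA.
Qed.

Lemma uA1_uB1 : commute uA1 uB1.
Proof. by have [/commute_of_conj] := conj_uA1. Qed.

Lemma uA2_uB2 : commute uA2 uB2.
Proof. by have [/commute_of_conj] := conj_uA2. Qed.

(** Conjugation by [uA1] agrees on [uB2] and [uC], hence on [s1], with conjugation by [s1^-1], which
    fixes [s1]. *)
Lemma s1_uA1 : commute s1 uA1.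
Proof.
have [_ b c] := conj_uA1; apply: commute_of_conj.
by rewrite conjMg conjVg b c -conjVg -conjMg -/s1 conjgE invgK mulgV mulg1.
Qed.

Lemma s2_uA2 : commute s2 uA2.
Proof.
have [_ b c] := conj_uA2; apply: commute_of_conj.
by rewrite conjMg conjVg b c -conjVg -conjMg -/s2 conjgE invgK mulgV mulg1.
Qed.

(* [uC^-1 = uB2^-1 * s1], so [uC^-1 * uA1] acts on [uB2] as [s1 * uA1] does. *)
Lemma uCA1_uB2 : commute uB2 (uC^-1 * uA1).
Proof.
have [_ b _] := conj_uA1; apply: commute_of_conj.
have -> : uC^-1 = uB2^-1 * s1 by rewrite mulKg.
rewrite conjgM conjgM [uB2 ^ uB2^-1](_ : _ = uB2); last by rewrite conjgE invgK mulgV mulg1.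
by rewrite -conjgM s1_uA1 conjgM b conjgKV.
Qed.

Lemma uA2C_uB1 : commute uB1 (uA2 * uC^-1).
Proof.
have [_ b _] := conj_uA2; apply: commute_of_conj.
have -> : uC^-1 = s2 * uB1^-1 by rewrite mulgK.
by rewrite mulgA conjgM conjgM b conjgKV conjgE invgK mulgV mulg1.
Qed.

End Relations.

Lemma theta_LZ1 w : theta1 (LZ w) 1%N = strip (LZ (false :: w)) /\
  theta2 (LZ w) 1%N = strip (LZ (true :: w)).
Proof. by split; apply: (etrans (seriesD _ _ _)); rewrite add0r. Qed.

Lemma strip_LZ (i : bool) w (A := useries (if i then uA2 else uA1) 1%N) :
  strip (LZ w) * A - A * strip (LZ w) = strip (LZ (i :: w)).
Proof.
have [t1 t2] := theta_LZ1 w.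
by rewrite /A; case: i {A} => /=; rewrite strip_alpha1 //; [exact: theta20|exact: theta10].
Qed.

(** On one-letter words the symbols of a1 and a2 strip the index of [LZ], which is what makes them
    generate a free Lie ring. *)
Lemma coef1_uA_LZ (i : bool) f w :
  useries (if i then uA2 else uA1) 1%N f [:: LZ w] = f [:: LZ (i :: w)].
Proof.
have [t1 t2] := theta_LZ1 w.
by case: i; apply: (etrans (alpha1_letter _ _ _)); rewrite ?t1 ?t2.
Qed.

(** * Injectivity of the symbol *)

Lemma lie_ring_flip (L : zmodType) (br : L -> L -> L) :
  lie_ring br -> lie_ring (fun x y => br y x).
Proof.
move=> brP; split=> [x y z|x y z|x|x y z].
- exact: brDr.
- exact: brDl.
- exact: brxx.
have [_ _ _ J] := brP; rewrite -(J x y z).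
have E a b c : br (br c b) a = br a (br b c).
  by rewrite (brC brP (br c b)) (brC brP c) (brNr brP) opprK.
by rewrite !E.
Qed.

Lemma lie_ring_prod (L L' : zmodType) (br : L -> L -> L) (br' : L' -> L' -> L') :
  lie_ring br -> lie_ring br' ->
  lie_ring (fun x y : L * L' => (br x.1 y.1, br' x.2 y.2)).
Proof.
move=> [Dl Dr xx J] [Dl' Dr' xx' J']; split=> *.
- by rewrite /= Dl Dl'.
- by rewrite /= Dr Dr'.
- by rewrite /= xx xx'.
- by rewrite -[LHS]/(_ + _, _ + _) /= J J'.
Qed.

Lemma lie_ring_commutator (R : pzRingType) : lie_ring (fun a b : R => a * b - b * a).
Proof.
split=> [x y z|x y z|x|x y z].
- by rewrite mulrDl mulrDr opprD addrACA.
- by rewrite mulrDl mulrDr opprD addrACA.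
- by rewrite subrr.
(* Jacobi identity: each of the six monomials in x, y, z occurs twice, with opposite signs. *)
have tele (a b c d e f : R) :
    (a - b - (c - d)) + (c - e - (f - b)) + (f - d - (a - e)) = 0.
  rewrite !opprB.
  rewrite [LHS](AC ((2*2)*(2*2)*(2*2)) ((1*2)*(7*8)*(9*10)*(3*4)*(5*6)*(11*12))) /=.
  by rewrite !addrA !subrK subrr.
by rewrite !mulrBr !mulrBl !mulrA tele.
Qed.

Definition comm (R : pzRingType) (a b : R) := a * b - b * a.

(** The quotient of x by y has first coefficient X - Y, which therefore commutes with that of z. *)
Lemma comm_coef1_div (R : pzRingType) (x y z : unipotent R) :
  commute z (x * y^-1)%g \/ commute z (y^-1 * x)%g ->
  comm (useries x 1%N) (useries z 1%N) = comm (useries y 1%N) (useries z 1%N).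
Proof.
move=> c; apply/eqP; rewrite -subr_eq0 -(brBl (lie_ring_commutator R)); apply/eqP.
case: c => /commute_sym/commute_coef1; rewrite unip_coef1M unip_coef1V //.
by rewrite [- _ + _]addrC.
Qed.

Lemma ustrip1 e : useries (ustrip e) 1%N = strip e.
Proof. by rewrite /= seriesD add0r. Qed.

Lemma unipotent_rel : PV3_lie_rel (@comm (endo wfun)) (useries uA1 1%N) (strip LB1)
  (useries uA2 1%N) (strip LB2) (strip LC) (strip (LZ [::])).
Proof.
rewrite -!ustrip1; split; [| | | |split].
- exact: commute_coef1 uA1_uB1.
- exact: commute_coef1 uA2_uB2.
- by apply/esym/comm_coef1_div; left; apply: uA2C_uB1.
- by apply/esym/comm_coef1_div; left; apply/commute_sym/s1_uA1.
- by apply/esym/comm_coef1_div; right; apply: uCA1_uB2.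
- by apply/esym/comm_coef1_div; right; apply/commute_sym/s2_uA2.
Qed.

Section Injectivity.
Variables (M : zmodType) (br : M -> M -> M).
Hypothesis brP : lie_ring br.
Variables A1 B1 A2 B2 C1 C2 : M.
Hypothesis rel : PV3_lie_rel br A1 B1 A2 B2 C1 C2.

Let L : zmodType := (endo wfun * M)%type.

(* Both factors carry the opposite bracket, as in [lbrack_lead]. *)
Definition pair_br (x y : L) : L := (opp_comm x.1 y.1, br y.2 x.2).

Let pair_brP : lie_ring pair_br.
Proof. exact: lie_ring_flip (lie_ring_prod (lie_ring_commutator _) brP). Qed.

Let genX (i : bool) : L :=
  if i then (useries uA2 1%N, A2) else (useries uA1 1%N, A1).

Fixpoint z_image w : M :=
  if w is i :: w' then br (z_image w') (genX i).2 else C2.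

Let genE (e : letter) : L := (strip e,
  match e with LB1 => B1 | LB2 => B2 | LC => C1 | LZ w => z_image w end).

Let LX := lie_gen pair_br (fun y => exists i, y = genX i).
Let LE := lie_gen pair_br (fun y => exists e, y = genE e).

Let LE_gen e : LE (genE e). Proof. by apply: lie_gen_in; exists e. Qed.

(** The relations, valid in both components, rewrite every bracket of A1 or A2 with B1, B2, C1 as
    zero or as a bracket of C1 with B1 or B2; bracketing with [LZ w] only lengthens its index. *)
Let genX_genE i e : LE (pair_br (genX i) (genE e)).
Proof.
have [r1 r2 r3 r4 [r5 r6]] := rel; have [u1 u2 u3 u4 [u5 u6]] := unipotent_rel.
have bC := brC brP.
have cC (a b : endo wfun) : comm a b = - comm b a := brC (lie_ring_commutator _) a b.
have pairE x y : pair_br x y = (comm y.1 x.1, br y.2 x.2) by [].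
have eC1 : pair_br (genE LC) (genE LB2) = pair_br (genX false) (genE LC).
  rewrite !pairE /=; congr pair; last by rewrite r4 (bC B2 A1) -r5 -bC.
  by rewrite u4 (cC (strip LB2) (useries uA1 1%N)) -u5 -cC.
have eC2 : pair_br (genE LC) (genE LB1) = pair_br (genX true) (genE LC).
  rewrite !pairE /=; congr pair; last by rewrite r6 (bC B1 A2) -r3 -bC.
  by rewrite u6 (cC (strip LB1) (useries uA2 1%N)) -u3 -cC.
have eq0 x : x = 0 -> LE x by move=> ->; apply: lie_gen0.
case: e => [|||w]; last 1 first.
- have -> : pair_br (genX i) (genE (LZ w)) = genE (LZ (i :: w)).
    rewrite /pair_br /genE /=; congr pair; rewrite -(strip_LZ i) /opp_comm.
    by case: i.
  exact: LE_gen.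
- case: i; last first.
    by apply: eq0; rewrite pairE /= bC cC r1 u1 !oppr0.
  have -> : pair_br (genX true) (genE LB1) = pair_br (genE LC) (genE LB1).
    rewrite !pairE /=; congr pair; last by rewrite bC -r3 -bC.
    by rewrite cC -u3 -cC.
  by apply: lie_gen_br; apply: LE_gen.
- case: i.
    by apply: eq0; rewrite pairE /= bC cC r2 u2 !oppr0.
  have -> : pair_br (genX false) (genE LB2) = pair_br (genE LC) (genE LB2).
    rewrite !pairE /=; congr pair; last by rewrite bC -r5 -bC.
    by rewrite cC -u5 -cC.
  by apply: lie_gen_br; apply: LE_gen.
- by case: i; rewrite -?eC1 -?eC2; apply: lie_gen_br; apply: LE_gen.
Qed.

Let LX_LE x y : LX x -> LE y -> LE (pair_br x y).
Proof.
move=> Lx; elim: Lx y => [|_ [i ->]|a b _ IHa _ IHb|a b _ IHa _ IHb] y Ly.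
- by rewrite (br0l pair_brP); apply: lie_gen0.
- apply: (lie_gen_der pair_brP) => // _ [e ->]; exact: genX_genE.
- by rewrite (brBl pair_brP); apply: lie_genB; [apply: IHa | apply: IHb].
- by rewrite (br_jacobi pair_brP); apply: lie_genB; [apply/IHa/IHb | apply/IHb/IHa].
Qed.

Definition pair_gens : seq L :=
  [:: genX false; genE LB1; genX true; genE LB2; genE LC; genE (LZ [::])].

(** [LX] normalizes [LE] by [LX_LE], so the sum of the two is closed under the bracket. *)
Let decomp x : lie_gen pair_br (fun y => y \in pair_gens) x ->
  exists y z, [/\ LX y, LE z & x = y + z].
Proof.
have LX0 : LX 0 := lie_gen0 _ _; have LE0 : LE 0 := lie_gen0 _ _.
elim=> [|y gy|_ _ _ [y [z [Ly Lz ->]]] _ [y' [z' [Ly' Lz' ->]]]|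
  _ _ _ [y [z [Ly Lz ->]]] _ [y' [z' [Ly' Lz' ->]]]].
- by exists 0, 0; rewrite addr0.
- have [[i ->]|[e ->]] : (exists i, y = genX i) \/ (exists e, y = genE e).
    move: gy; rewrite !inE => /or4P[|||/or3P[||]] /eqP ->;
      [left|right|left|right|right|right]; by eexists.
    by exists (genX i), 0; rewrite addr0; split=> //; apply: lie_gen_in; exists i.
  by exists 0, (genE e); rewrite add0r.
- exists (y - y'), (z - z'); rewrite opprD addrACA.
  by split=> //; apply: lie_genB.
- exists (pair_br y y'), (pair_br y z' + (pair_br z y' + pair_br z z')).
  rewrite (brDl pair_brP) !(brDr pair_brP) !addrA; split=> //; first exact: lie_gen_br.
  apply: lie_genD; last exact: lie_gen_br.
  apply: lie_genD; first exact: LX_LE.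
  by rewrite (brC pair_brP); apply/lie_genN/LX_LE.
Qed.

(** Every operator coming from [LE] consumes at least one letter, so a function supported on words
    of length at most one is sent to one supported on the empty word. *)
Let LE_strip x (f : wfun) w : LE x ->
  (forall v, (1 < size v)%N -> f v = 0) -> (0 < size w)%N -> x.1 f w = 0.
Proof.
move=> Lx; elim: Lx f w => [|_ [e ->]|a b _ IHa _ IHb|a b _ IHa _ IHb] f w f0 w0 //.
- exact: (f0 (e :: w)).
- by rewrite -[(a - b).1]/(a.1 - b.1) endo_addE endo_oppE fctBE IHa ?IHb ?subr0.
rewrite -[(pair_br a b).1]/(b.1 * a.1 - a.1 * b.1) endo_addE endo_oppE !endo_mulE fctBE.
rewrite IHb ?IHa ?subr0 // => v v1; [apply: IHb | apply: IHa] => //; exact: ltnW.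
Qed.

Let pair_sum1 (I : eqType) (r : seq I) (F : I -> L) (c : I -> int) :
  (\sum_(l <- r) F l *~ c l).1 = \sum_(l <- r) (F l).1 *~ c l.
Proof.
have Hn (a : L) n : (a *+ n).1 = a.1 *+ n by elim: n => // n IH; rewrite !mulrS /= -IH.
have Hz (a : L) (n : int) : (a *~ n).1 = a.1 *~ n.
  by case: n => n; rewrite ?NegzE ?mulrNz -?pmulrn /= Hn.
by elim/big_rec2: _ => //= i y z _ <-; rewrite Hz.
Qed.

(** Write (0, m) = y + z by [decomp] and expand y, then z, in Lyndon brackets. The integer
    coefficients are shared by the two components, so independence of the operators forces y and z
    themselves to vanish, and with them m. *)
Theorem pair_inj m : lie_gen pair_br (fun y => y \in pair_gens) (0, m) -> m = 0.
Proof.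
move=> /decomp[y [z [Ly Lz e]]].
have e1 : y.1 + z.1 = 0 by rewrite -[RHS]/((0, m) : L).1 e.
have [s [c [us Ls ey]]] := zspan_lyndonP (lie_gen_lyndon pair_brP Ly).
have fstb (T : countType) (u : T -> L) l :
    (lbrack pair_br u l).1 = lbrack (@opp_comm _) (fun i => (u i).1) l.
  exact: (@lbrack_morph _ _ pair_br (@opp_comm _) fst).
(* Test functions supported on the words [[:: LZ w]] do not see z, by [LE_strip], so y is handled
   first. *)
have cs : forall l, l \in s -> c l = 0.
  apply: (@lbrack_indep _ _ (fun i => (genX i).1) (fun w => [:: LZ w])) us Ls _ => //.
  - by move=> i f w; rewrite -coef1_uA_LZ; case: i.
  - by move=> w w' [].
  move=> f f0; under eq_bigr do rewrite -fstb; rewrite -pair_sum1 -ey.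
  have -> : y.1 = - z.1 by apply/eqP; rewrite -addr_eq0 e1.
  rewrite endo_oppE opprfctE LE_strip ?oppr0 // => v v1; apply: f0 => w ev.
  by rewrite ev in v1.
have y0 : y = 0 by rewrite ey big1_seq // => l /andP[_ /cs ->]; rewrite mulr0z.
have [t [d [ut Lt ez]]] := zspan_lyndonP (lie_gen_lyndon pair_brP Lz).
(* Once y = 0, the operator of z is zero and the stripping operators can be tested on all
   functions. *)
have ct : forall l, l \in t -> d l = 0.
  apply: (@lbrack_indep _ _ (fun e => (genE e).1) id) ut Lt _ => //.
  move=> f _; under eq_bigr do rewrite -fstb; rewrite -pair_sum1 -ez.
  by move: e1; rewrite y0 add0r => ->.
have z0 : z = 0 by rewrite ez big1_seq // => l /andP[_ /ct ->]; rewrite mulr0z.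
by move: e; rewrite y0 z0 addr0 => -[].
Qed.

End Injectivity.

(** * The lower central series of PV_3 *)

Local Close Scope ring_scope.

Section Subgroups.
Variable G : groupType.
Local Open Scope group_scope.
Implicit Types (K : G -> Prop) (x y : G).

Lemma subgroup1 K : is_subgroup K -> K 1. Proof. by case. Qed.

Lemma subgroupV K x : is_subgroup K -> K x -> K x^-1.
Proof. by move=> [K1 KB] Kx; rewrite -[x^-1]mul1g; apply: KB. Qed.

Lemma subgroupM K x y : is_subgroup K -> K x -> K y -> K (x * y).
Proof. by move=> KP Kx Ky; rewrite -[y]invgK; apply: KP.2 => //; apply: subgroupV. Qed.

Lemma gen_subgroupP (S : G -> Prop) : is_subgroup (gen_subgroup S).
Proof.
split=> [H HP _|x y Sx Sy H HP SH]; first exact: subgroup1.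
by apply: HP.2; [apply: Sx | apply: Sy].
Qed.

Lemma lcs_subgroup d : is_subgroup (@lcs G d).
Proof. by case: d => [|d] //; apply: gen_subgroupP. Qed.

Lemma lcs_comm d x y : lcs d x -> lcs d.+1 [~ x, y].
Proof. by move=> dx H HP; apply; exists x, y. Qed.

Lemma lcs_ind d K : is_subgroup K -> (forall x y, lcs d x -> K [~ x, y]) ->
  forall x, lcs d.+1 x -> K x.
Proof. by move=> KP H x; apply=> // _ [y [z [dy ->]]]; apply: H. Qed.

End Subgroups.

Section Presentation.
Variables (G : groupType) (lam : nat -> nat -> G).
Hypothesis lamP : presents_PV3 lam.
Local Open Scope group_scope.

Section Generation.
Variable K : G -> Prop.
Hypothesis KP : is_subgroup K.

Record subgroup_type := SubgroupElt {sg_val : G; sg_valP : K sg_val}.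

Let sg_inj : injective sg_val.
Proof.
by case=> [x Kx] [y Ky] /= e; rewrite e in Kx *; congr SubgroupElt; apply: Prop_irrelevance.
Qed.

Let sg1 := SubgroupElt (subgroup1 KP).
Let sgM x y := SubgroupElt (subgroupM KP (sg_valP x) (sg_valP y)).
Let sgV x := SubgroupElt (subgroupV KP (sg_valP x)).

HB.instance Definition _ := gen_eqMixin subgroup_type.
HB.instance Definition _ := gen_choiceMixin subgroup_type.

Let sgA : associative sgM. Proof. by move=> x y z; apply: sg_inj; apply: mulgA. Qed.
Let sg1g : left_id sg1 sgM. Proof. by move=> x; apply: sg_inj; apply: mul1g. Qed.
Let sgg1 : right_id sg1 sgM. Proof. by move=> x; apply: sg_inj; apply: mulg1. Qed.
Let sgVg : left_inverse sg1 sgV sgM. Proof. by move=> x; apply: sg_inj; apply: mulVg. Qed.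
Let sggV : right_inverse sg1 sgV sgM. Proof. by move=> x; apply: sg_inj; apply: mulgV. Qed.

HB.instance Definition _ := isGroup.Build subgroup_type sgA sg1g sgg1 sgVg sggV.

(** The universal property maps G to the subgroup [K]; followed by the inclusion this is the
    identity, by uniqueness. *)
Lemma presented_gen : (forall i j, idx3 i -> idx3 j -> i != j -> K (lam i j)) ->
  forall x, K x.
Proof.
move=> Klam; have [rel univ] := lamP.
(* [K] is not known to contain [lam i j] for inadmissible index pairs, hence the default value 1. *)
pose mu i j : subgroup_type :=
  if pselect (K (lam i j)) is left p then SubgroupElt p else 1.
have muE i j : idx3 i -> idx3 j -> i != j -> sg_val (mu i j) = lam i j.
  by move=> i3 j3 /(Klam _ _ i3 j3) Kij; rewrite /mu; case: pselect.
have [f [fM fE _]] : exists f : G -> subgroup_type, [/\ group_hom f,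
    (forall i j, idx3 i -> idx3 j -> i != j -> f (lam i j) = mu i j) &
    (forall g : G -> subgroup_type, group_hom g ->
       (forall i j, idx3 i -> idx3 j -> i != j -> g (lam i j) = mu i j) ->
       forall x, g x = f x)].
  apply: univ => k i j k3 i3 j3 ki kj ij; apply: sg_inj.
  rewrite -[LHS]/(sg_val (mu k i) * sg_val (mu k j) * sg_val (mu i j)).
  rewrite -[RHS]/(sg_val (mu i j) * sg_val (mu k j) * sg_val (mu k i)).
  by rewrite !muE //; apply: rel.
have [h [_ _ uniq_h]] := univ G lam rel.
move=> x; have -> : x = sg_val (f x); last exact: sg_valP.
rewrite [LHS](uniq_h id) // -(uniq_h (sg_val \o f)) //=.
  by move=> y z; rewrite /= fM.
by move=> i j i3 j3 ij /=; rewrite fE // muE.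
Qed.

End Generation.

Let a1 := PV3_a1 lam.
Let b1 := PV3_b1 lam.
Let a2 := PV3_a2 lam.
Let b2 := PV3_b2 lam.
Let c1 := PV3_c1 lam.
Let c2 := PV3_c2 lam.

Lemma presented_gen_abc (K : G -> Prop) : is_subgroup K ->
  (forall x, x \in [:: a1; b1; a2; b2; c1; c2] -> K x) -> forall x, K x.
Proof.
move=> KP Kabc; apply: presented_gen => // i j.
have [Ka1 Kb1 Ka2] : [/\ K a1, K b1 & K a2] by split; apply: Kabc; rewrite !inE eqxx ?orbT.
have [Kb2 Kc1 Kc2] : [/\ K b2, K c1 & K c2] by split; apply: Kabc; rewrite !inE eqxx ?orbT.
have KV x := @subgroupV _ K x KP; have KM x y := @subgroupM _ K x y KP.
have K13 : K (lam 1 3)%N by [].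
have K12 : K (lam 1 2)%N by rewrite -[lam 1 2](mulKg (lam 1 3)%N); apply/KM/Kb1/KV.
have K23 : K (lam 2 3)%N by rewrite -[lam 2 3](mulKg (lam 1 3)%N); apply/KM/Ka1/KV.
have K31 : K (lam 3 1)%N by rewrite -[lam 3 1](mulKg (lam 1 3)%N); apply/KM/Kc1/KV.
have K32 : K (lam 3 2)%N by rewrite -[lam 3 2](mulgK (lam 3 1)%N); apply/KM/KV.
have K21 : K (lam 2 1)%N by rewrite -[lam 2 1](mulgK (lam 3 1)%N); apply/KM/KV.
by rewrite /idx3 !inE => /or3P[]/eqP-> /or3P[]/eqP->.
Qed.

(** After cancellation, for instance a2 c1^-1 = lambda_32 lambda_13^-1, each commuting pair is one
    of the six defining relations. *)
Lemma PV3_commute : [/\ commute a1 b1, commute a2 b2, commute (a2 * c1^-1) b1,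
  commute (b2 * c1^-1) a1 & commute (c1^-1 * a1) b2 /\ commute (c1^-1 * b1) a2].
Proof.
have [rel _] := lamP; rewrite /commute.
have r k i j := rel k i j.
have -> : a2 * c1^-1 = lam 3 2 * (lam 1 3)^-1 by rewrite /c1 /PV3_c1 invgM mulgA mulgK.
have -> : b2 * c1^-1 = lam 2 1 * (lam 1 3)^-1 by rewrite /c1 /PV3_c1 invgM mulgA mulgK.
have -> : c1^-1 * a1 = (lam 3 1)^-1 * lam 2 3 by rewrite /c1 /PV3_c1 invgM -mulgA mulKg.
have -> : c1^-1 * b1 = (lam 3 1)^-1 * lam 1 2 by rewrite /c1 /PV3_c1 invgM -mulgA mulKg.
split; [| | | |split].
- have := (r 1 2 3)%N isT isT isT isT isT isT.
  by rewrite -!mulgA => e; rewrite /a1 /b1 /PV3_a1 /PV3_b1 -?mulgA e.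
- have := (r 3 2 1)%N isT isT isT isT isT isT.
  by move=> e; rewrite /a2 /b2 /PV3_a2 /PV3_b2 ?mulgA e.
- have := (r 1 3 2)%N isT isT isT isT isT isT.
  by move=> e; rewrite /b1 /PV3_b1 ?mulgA e mulgVK mulgK.
- have := (r 2 1 3)%N isT isT isT isT isT isT.
  by move=> e; rewrite /a1 /PV3_a1 ?mulgA -e mulgVK mulgK.
- have := (r 2 3 1)%N isT isT isT isT isT isT.
  by rewrite -!mulgA => e; rewrite /b2 /PV3_b2 -?mulgA e mulKg mulVKg.
- have := (r 3 1 2)%N isT isT isT isT isT isT.
  by rewrite -!mulgA => e; rewrite /a2 /PV3_a2 -?mulgA -e mulKg mulVKg.
Qed.

Lemma commgMl_commute (x y z : G) : commute x z -> [~ x * y, z] = [~ y, z].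
Proof.
move=> xz; rewrite !commgEl conjMg [x ^ z](_ : _ = x); last by rewrite conjgE xz mulKg.
by rewrite invgM -!mulgA mulKg.
Qed.

(** [x y, z] is the conjugate of [x, z] by y, and conjugation does not change a class modulo
    gamma_3. *)
Lemma same_class_commgMr (x y z : G) : commute y z -> same_class 1%N [~ x * y, z] [~ x, z].
Proof.
move=> yz; have -> : [~ x * y, z] = [~ x, z] ^ y.
  rewrite !commgEl !conjMg conjVg [y ^ z](_ : _ = y); last by rewrite conjgE yz mulKg.
  by rewrite -conjVg !conjgE invgM -!mulgA ?mulVKg ?mulKVg.
rewrite /same_class; set w := [~ x, z].
have w1 : lcs 1 w by apply: lcs_comm.
have -> : w ^ y * w^-1 = [~ w^-1, y]^-1.
  by rewrite commgEl conjVg !invgM !invgK.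
apply: (subgroupV (lcs_subgroup G 2)); apply: (@lcs_comm _ 1).
exact: (subgroupV (lcs_subgroup G 1)).
Qed.

Lemma same_class_refl d (x y : G) : x = y -> same_class d x y.
Proof. by move=> ->; rewrite /same_class mulgV; apply: (subgroup1 (lcs_subgroup G d.+1)). Qed.

(** The first four relations hold in the group itself, because the factor commuting with the second
    entry stands on the left. In the last two it stands on the right, and they hold modulo
    gamma_3. *)
Lemma PV3_same_class :
  [/\ same_class 1%N [~ a1, b1] 1, same_class 1%N [~ a2, b2] 1,
      same_class 1%N [~ c1, b1] [~ a2, b1], same_class 1%N [~ c1, a1] [~ b2, a1] &
      same_class 1%N [~ c1, b2] [~ a1, b2] /\ same_class 1%N [~ c1, a2] [~ b1, a2]].
Proof.
have [r1 r2 r3 r4 [r5 r6]] := PV3_commute.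
have comm1 x y : commute x y -> [~ x, y] = 1 :> G.
  by move=> xy; rewrite commgEl conjgE xy mulKg mulVg.
have split_l x y : y = (x * y^-1)^-1 * x :> G by rewrite invgF mulgVK.
have split_r x y : y = x * (y^-1 * x)^-1 :> G by rewrite invgM invgK mulVKg.
split; [| | | |split].
- exact: same_class_refl (comm1 _ _ r1).
- exact: same_class_refl (comm1 _ _ r2).
- apply: same_class_refl; rewrite {1}(split_l a2 c1); apply: commgMl_commute.
  exact/commute_sym/commuteV/commute_sym.
- apply: same_class_refl; rewrite {1}(split_l b2 c1); apply: commgMl_commute.
  exact/commute_sym/commuteV/commute_sym.
- rewrite {1}(split_r a1 c1); apply: same_class_commgMr.
  exact/commute_sym/commuteV/commute_sym.
- rewrite {1}(split_r b1 c1); apply: same_class_commgMr.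
  exact/commute_sym/commuteV/commute_sym.
Qed.

Lemma PV3_lie_span d x : lcs d x -> lie_span [:: a1; b1; a2; b2; c1; c2] d x.
Proof.
set s := [:: _; _; _; _; _; _].
have c2s : lie_span s 0 c2 by apply: ls_gen; rewrite !inE eqxx !orbT.
(* [lie_span] has no constructor for the identity; in higher degree it is obtained as [1, c2]. *)
have span1 n : lie_span s n 1.
  elim: n => [|n IH]; first by rewrite -(mulgV c2); apply: ls_sub.
  have := ls_br IH c2s; rewrite addn0 (_ : [~ 1, c2] = 1) //.
  by rewrite commgEl conj1g mulVg.
have span_sub n : is_subgroup (lie_span s n) by split=> // y z; apply: ls_sub.
have span0 : forall y, lie_span s 0 y.
  by apply: presented_gen_abc => // y ys; apply: ls_gen.
elim: d x => [|d IH] x; first by move=> _; apply: span0.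
apply: lcs_ind => // y z /IH dy; have := ls_br dy (span0 z).
by rewrite addn0.
Qed.

End Presentation.

(** * The Lie ring homomorphism *)

Section PV3Assignment.
Variable G : groupType.
Local Open Scope group_scope.

(** The formulas for a1, ..., c2 solved for the generators lambda_ij, so that a homomorphism can be
    prescribed on a1, ..., c2. *)
Definition PV3_assign (a1 b1 a2 b2 c1 c2 : G) (i j : nat) : G :=
  match i, j with
  | 1%N, 2%N => c2^-1 * b1
  | 1%N, 3%N => c2
  | 2%N, 1%N => b2 * c1^-1 * c2
  | 2%N, 3%N => c2^-1 * a1
  | 3%N, 1%N => c2^-1 * c1
  | 3%N, 2%N => a2 * c1^-1 * c2
  | _, _ => 1
  end.

Lemma PV3_assign_rel (a1 b1 a2 b2 c1 c2 : G) :
  commute a1 b1 -> commute a2 b2 -> commute (a2 * c1^-1) b1 ->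
  commute (b2 * c1^-1) a1 -> commute (c1^-1 * a1) b2 -> commute (c1^-1 * b1) a2 ->
  PV3_rel (PV3_assign a1 b1 a2 b2 c1 c2).
Proof.
rewrite /commute -!mulgA => r1 r2 r3 r4 r5 r6 k i j.
rewrite /idx3 !inE => /or3P[]/eqP-> /or3P[]/eqP-> /or3P[]/eqP->; rewrite ?eqxx // => _ _ _.
all: rewrite /PV3_assign -!mulgA ?mulVKg ?mulKVg.
- by rewrite r1.
- by have := congr1 (fun x => x * c2) r3; rewrite /= -!mulgA => ->.
- by have := congr1 (fun x => x * c2) r4; rewrite /= -!mulgA => ->.
- by rewrite mulVg mulg1 -r5 mulVKg.
- by rewrite mulVg mulg1 -r6 mulVKg.
- by rewrite !mulKg mulgA r2 -mulgA.
Qed.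

End PV3Assignment.

Section LieHom.
Variables (G : groupType) (lam : nat -> nat -> G).
Hypothesis lamP : presents_PV3 lam.
Variables (M : zmodType) (br : M -> M -> M).
Hypothesis brP : lie_ring br.
Variables A1 B1 A2 B2 C1 C2 : M.
Hypothesis rel : PV3_lie_rel br A1 B1 A2 B2 C1 C2.
Local Open Scope ring_scope.

Let L : zmodType := (endo wfun * M)%type.
Let gens : seq L := pair_gens br A1 B1 A2 B2 C1 C2.
Let R : L -> Prop := lie_gen (pair_br br) (fun y => y \in gens).

Variable rho : G -> unipotent (endo wfun).
Hypothesis rhoM : group_hom rho.

Let a1 := PV3_a1 lam.
Let b1 := PV3_b1 lam.
Let a2 := PV3_a2 lam.
Let b2 := PV3_b2 lam.
Let c1 := PV3_c1 lam.
Let c2 := PV3_c2 lam.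

Hypothesis rho_gens : [/\ rho a1 = uA1, rho b1 = ustrip LB1, rho a2 = uA2,
  rho b2 = ustrip LB2 & rho c1 = ustrip LC /\ rho c2 = ustrip (LZ [::])].

Let rho1 : rho 1%g = 1%g.
Proof. by apply: (@mulgI _ (rho 1%g)); rewrite -rhoM !mulg1. Qed.
Let rhoV x : rho x^-1%g = (rho x)^-1%g.
Proof. by apply: (@mulgI _ (rho x)); rewrite -rhoM !mulgV. Qed.
Let rhoC x y : rho [~ x, y]%g = [~ rho x, rho y]%g.
Proof. by rewrite /commg /conjg !rhoM !rhoV. Qed.

Let coef d x : endo wfun := useries (rho x) d.+1.

(** The graph of the homomorphism sought: the coefficient of t^(d+1) in [rho x] is paired with an
    element of M through the Lie ring generated by the six pairs. Uniqueness of that element is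
    [pair_inj]. *)
Let has_symbol d x (m : M) := lead d (rho x) (coef d x) /\ R (coef d x, m).

Let has_symbol_inj d x m m' : has_symbol d x m -> has_symbol d x m' -> m = m'.
Proof.
move=> [_ Rm] [_ Rm']; apply/eqP; rewrite -subr_eq0; apply/eqP.
apply: (pair_inj brP rel); have := lie_genB Rm Rm'.
by have -> : (coef d x, m) - (coef d x, m') = (0, m - m') :> L
  by congr pair; apply: subrr.
Qed.

Let has_symbol_div d x y m n : has_symbol d x m -> has_symbol d y n ->
  has_symbol d (x * y^-1)%g (m - n).
Proof.
move=> [lx Rx] [ly Ry]; have l := lead_unip_div lx ly.
rewrite -rhoV -rhoM in l; have e : coef d (x * y^-1)%g = coef d x - coef d y := l.2.
by split; rewrite e //; apply: (lie_genB Rx Ry).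
Qed.

Let has_symbol_comm d e x y m n : has_symbol d x m -> has_symbol e y n ->
  has_symbol (d + e).+1 [~ x, y]%g (br m n).
Proof.
move=> [lx Rx] [ly Ry]; have l := lead_unip_comm lx ly.
rewrite -rhoC in l.
have E : coef (d + e).+1 [~ x, y]%g = coef d x * coef e y - coef e y * coef d x := l.2.
(* [pair_br] is the opposite bracket, hence y before x. *)
by split; rewrite E //; apply: (lie_gen_br Ry Rx).
Qed.

Let has_symbol0 d x : lead d (rho x) 0 -> has_symbol d x 0.
Proof. by move=> l; rewrite /has_symbol /coef l.2; split=> //; apply: lie_gen0. Qed.

Let has_symbol1 d : has_symbol d 1%g 0.
Proof. by apply: has_symbol0; rewrite rho1; apply: lead_unip1. Qed.

Let symbolic d x := exists m, has_symbol d x m.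

Let symbolic_subgroup d : is_subgroup (symbolic d).
Proof.
split=> [|x y [m xm] [n yn]]; first by exists 0.
by exists (m - n); apply: has_symbol_div.
Qed.

Let has_symbol_gens : [/\ has_symbol 0 a1 A1, has_symbol 0 b1 B1, has_symbol 0 a2 A2 &
  [/\ has_symbol 0 b2 B2, has_symbol 0 c1 C1 & has_symbol 0 c2 C2]].
Proof.
have [ra1 rb1 ra2 rb2 [rc1 rc2]] := rho_gens.
have H x D m : rho x = D -> (useries D 1%N, m) \in gens -> has_symbol 0 x m.
  by move=> <- i; split; [apply: lead0 | apply: lie_gen_in].
have e := ustrip1.
by split; [| | |split]; apply: H; eauto; rewrite ?e /gens /pair_gens !inE eqxx ?orbT.
Qed.

(** Degree 0 follows from generation by a1, ..., c2; each further degree is generated by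
    commutators, whose symbols are brackets. *)
Let lcs_symbolic d x : lcs d x -> symbolic d x.
Proof.
have [h1 h2 h3 [h4 h5 h6]] := has_symbol_gens.
have all0 : forall y, symbolic 0 y.
  apply: (presented_gen_abc lamP) => // y; rewrite !inE.
  by move=> /or4P[|||/or3P[||]] /eqP->; eexists; eassumption.
elim: d x => [|d IH] x; first by move=> _; apply: all0.
apply: lcs_ind => // y z /IH[m ym]; have [n zn] := all0 z.
by exists (br m n); have := has_symbol_comm ym zn; rewrite addn0.
Qed.

Let symbol d x : M :=
  if pselect (symbolic d x) is left e then sval (cid e) else 0.

Let symbolE d x m : has_symbol d x m -> symbol d x = m.
Proof.
move=> xm; rewrite /symbol; case: pselect => [e|[]]; last by exists m.
exact: has_symbol_inj (svalP (cid e)) xm.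
Qed.

Lemma symbol_lie_hom : exists f : nat -> G -> M,
  [/\ graded_lie_hom br f, f 0%N a1 = A1, f 0%N b1 = B1, f 0%N a2 = A2 &
      [/\ f 0%N b2 = B2, f 0%N c1 = C1 & f 0%N c2 = C2]].
Proof.
have [h1 h2 h3 [h4 h5 h6]] := has_symbol_gens.
exists symbol; split; [|exact: symbolE|exact: symbolE|exact: symbolE|split; exact: symbolE].
split=> [d x y /lcs_symbolic[m xm] /lcs_symbolic[n yn]|d x /lcs_symbolic[m [[o _] _]]|
  d e x y /lcs_symbolic[m xm] /lcs_symbolic[n yn]].
- rewrite (symbolE xm) (symbolE yn); apply: symbolE.
  have := has_symbol_div xm (has_symbol_div (has_symbol1 d) yn).
  by rewrite mul1g invgK sub0r opprK.
(* An element of gamma_(d+2) acts as 1 up to and including t^(d+1), so its symbol in degree index d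
   is zero. *)
- apply/symbolE/has_symbol0; split; first by move=> i lt; apply/o/ltnW.
  by have := o d.+1 (ltnSn _); rewrite seriesB series1 subr0.
- by rewrite (symbolE xm) (symbolE yn); apply/symbolE/has_symbol_comm.
Qed.

End LieHom.

Lemma PV3_rep (G : groupType) (lam : nat -> nat -> G) : presents_PV3 lam ->
  exists rho : G -> unipotent (endo wfun), group_hom rho /\
    [/\ rho (PV3_a1 lam) = uA1, rho (PV3_b1 lam) = ustrip LB1, rho (PV3_a2 lam) = uA2,
        rho (PV3_b2 lam) = ustrip LB2 &
        rho (PV3_c1 lam) = ustrip LC /\ rho (PV3_c2 lam) = ustrip (LZ [::])].
Proof.
move=> [_ univ].
have [|rho [rhoM rhoE _]] := univ _ (PV3_assign uA1 (ustrip LB1) uA2 (ustrip LB2)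
  (ustrip LC) (ustrip (LZ [::]))).
  apply: PV3_assign_rel.
  - exact: uA1_uB1.
  - exact: uA2_uB2.
  - exact/commute_sym/uA2C_uB1.
  - exact: s1_uA1.
  - exact/commute_sym/uCA1_uB2.
  - exact: s2_uA2.
exists rho; split=> //.
rewrite /PV3_a1 /PV3_b1 /PV3_a2 /PV3_b2 /PV3_c1 /PV3_c2 !rhoM !rhoE //=.
by split; rewrite ?mulVKg ?mulgA ?mulgK ?mulgVK //; split; rewrite ?mulVKg.
Qed.

(* L(PV_3) is the quotient of the free Lie ring on A1,B1,A2,B2,C1,C2 by the
   six relations, stated as: (i) the classes A1..C2 (degree 1 = index 0 of
   lcs) satisfy the relations in L(PV_3); (ii) they generate L(PV_3) as a
   Lie ring; (iii) for every Lie ring M and elements of M satisfying the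
   relations there is a Lie ring homomorphism L(PV_3) -> M sending
   A1,..,C2 to them.  (Together: the canonical map from the presented Lie
   ring to L(PV_3) is an isomorphism.) *)
Theorem theorem5p1 (G : groupType) (lam : nat -> nat -> G) :
  presents_PV3 lam ->
  let a1 := PV3_a1 lam in
  let b1 := PV3_b1 lam in
  let a2 := PV3_a2 lam in
  let b2 := PV3_b2 lam in
  let c1 := PV3_c1 lam in
  let c2 := PV3_c2 lam in
  [/\ [/\ same_class 1%N [~ a1, b1]%g 1%g,
          same_class 1%N [~ a2, b2]%g 1%g,
          same_class 1%N [~ c1, b1]%g [~ a2, b1]%g,
          same_class 1%N [~ c1, a1]%g [~ b2, a1]%g &
          [/\ same_class 1%N [~ c1, b2]%g [~ a1, b2]%g &
          same_class 1%N [~ c1, a2]%g [~ b1, a2]%g]],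
      (forall d x, lcs d x -> lie_span [:: a1; b1; a2; b2; c1; c2] d x) &
      (forall (M : zmodType) (br : M -> M -> M) (A1 B1 A2 B2 C1 C2 : M),
         lie_ring br -> PV3_lie_rel br A1 B1 A2 B2 C1 C2 ->
         exists f : nat -> G -> M,
           [/\ graded_lie_hom br f,
               f 0 a1 = A1, f 0 b1 = B1, f 0 a2 = A2 &
               [/\ f 0 b2 = B2, f 0 c1 = C1 & f 0 c2 = C2]])].
Proof.
move=> lamP a1 b1 a2 b2 c1 c2; split.
- exact: PV3_same_class.
- exact: PV3_lie_span.
- move=> M br A1 B1 A2 B2 C1 C2 brP rel.
  have [rho [rhoM rho_gens]] := PV3_rep lamP.
  exact: (symbol_lie_hom lamP brP rel rhoM rho_gens).
Qed.
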